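(* Let $n\in\mathbb{N}$ and let $p$ be a positive even integer. Let $A_{i_1,i_2,\dots,i_p}$, $(i_1,\dots,i_p)\in\{1,\dots,n\}^p$, be standard normal random variables. Let $g$ be a standard normal random variable, and for each $j\in\{1,\dots,p\}$ let $\mathbf{g}^{(j)}\in\mathbb{R}^{n}$ be a vector with standard normal entries and $A^{(j)}=(A^{(j)}_{i_1,\dots,i_p})_{(i_1,\dots,i_p)\in\{1,\dots,n\}^p}$ be an order-$p$ array with standard normal entries. Assume all these random variables are mutually independent. Let $\mathcal{S}^{(j)}\subseteq\mathbb{S}^n$, $1\le j\le p$, and write $\bar{\mathcal{S}}=(\mathcal{S}^{(j)})_{j=1}^p$. For $c_3>0$ define $$\varphi(p;\bar{\mathcal S},n)=\max_{\mathbf{x}^{(j)}\in\mathcal{S}^{(j)},\,1\le j\le p}\ \sum_{i_1,\dots,i_p=1}^n A_{i_1,\dots,i_p}\prod_{j=1}^p \mathbf{x}^{(j)}_{i_j},$$ $$\xi(p;\bar{\mathcal S},n,c_3)=\frac{1}{\sqrt n}\,\frac{1}{c_3}\log\Big(\mathbb{E}\, e^{c_3\varphi(p;\bar{\mathcal S},n)}\Big),$$ $$\xi_u(p;\bar{\mathcal S},n,c_3)=\frac{1}{\sqrt n}\left(-\frac{c_3}{2}(p-1)+\frac{1}{c_3}\log\Big(\mathbb{E}\, e^{c_3\max_{\mathbf{x}^{(j)}\in\mathcal S^{(j)}}\sum_{j=1}^p(\mathbf g^{(j)})^T\mathbf x^{(j)}}\Big)\right),$$ $$\xi_l(p;\bar{\mathcal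 S},n,c_3)=\frac{1}{\sqrt n}\,\frac{1}{c_3}\log\Big(\mathbb{E}\, e^{\frac{c_3}{\sqrt p}\max_{\mathbf{x}^{(j)}\in\mathcal S^{(j)}}\sum_{j=1}^p\sum_{i_1,\dots,i_p=1}^n A^{(j)}_{i_1,\dots,i_p}\prod_{k=1}^p \mathbf{x}^{(j)}_{i_k}}\Big).$$ Then for all real $c_{3,l}>0$ and $c_{3,u}>0$, $$\xi_l(p;\bar{\mathcal S},n,c_{3,l})\le \xi(p;\bar{\mathcal S},n,c_{3,l})\quad\text{and}\quad \xi(p;\bar{\mathcal S},n,c_{3,u})\le \xi_u(p;\bar{\mathcal S},n,c_{3,u}).$$
   Context: $\mathbb{S}^n=\{\mathbf x\in\mathbb R^n:\|\mathbf x\|_2=1\}$ denotes the unit sphere in $\mathbb R^n$. For a vector $\mathbf x$, $\mathbf x_i$ denotes its $i$-th coordinate. All maxima over the sets $\mathcal S^{(j)}$ are taken jointly over $(\mathbf x^{(1)},\dots,\mathbf x^{(p)})\in\mathcal S^{(1)}\times\cdots\times\mathcal S^{(p)}$. *)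

(* Defs.v *)
From HB Require Import structures.
From mathcomp Require Import all_boot all_order all_algebra.
From mathcomp Require Import all_classical all_reals all_analysis.
Set Implicit Arguments. Unset Strict Implicit. Unset Printing Implicit Defensive.
Import Order.TTheory GRing.Theory Num.Theory.
Local Open Scope classical_set_scope.
Local Open Scope ring_scope.

Definition std_normal {d} {T : measurableType d} {R : realType}
  (P : probability T R) (X : T -> R) : Prop :=
  measurable_fun setT X /\
  forall B : set R, measurable B -> P (X @^-1` B) = normal_prob 0 1 B.

Definition mutually_independent {d} {T : measurableType d} {R : realType}
  (P : probability T R) {I : Type} (X : I -> T -> R) : Prop :=
  forall (k : nat) (idx : 'I_k -> I), injective idx ->
  forall B : 'I_k -> set R, (forall i, measurable (B i)) ->
  P (\bigcap_(i in [set: 'I_k]) (X (idx i) @^-1` B i)) =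
  (\prod_(i < k) P (X (idx i) @^-1` B i))%E.

Definition sphere (R : realType) (n : nat) : set ('I_n -> R) :=
  [set v | \sum_(i < n) v i ^+ 2 = 1].

Definition maxS {R : realType} (n p : nat) (S : 'I_p -> set ('I_n -> R))
  (f : ('I_p -> 'I_n -> R) -> R) : R :=
  sup [set f x | x in [set x : 'I_p -> 'I_n -> R | forall j, S j (x j)]].

Notation midx n p := {ffun 'I_p -> 'I_n}.

Definition phi {R : realType} (n p : nat) (S : 'I_p -> set ('I_n -> R))
  (A : midx n p -> R) : R :=
  maxS S (fun x => \sum_(i : midx n p) A i * \prod_(j < p) x j (i j)).

Definition phi_u {R : realType} (n p : nat) (S : 'I_p -> set ('I_n -> R))
  (G : 'I_p -> 'I_n -> R) : R :=
  maxS S (fun x => \sum_(j < p) \sum_(i < n) G j i * x j i).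

Definition phi_l {R : realType} (n p : nat) (S : 'I_p -> set ('I_n -> R))
  (B : 'I_p -> midx n p -> R) : R :=
  maxS S (fun x => \sum_(j < p) \sum_(i : midx n p)
                     B j i * \prod_(k < p) x j (i k)).

Local Open Scope ereal_scope.

Definition xi {d} {T : measurableType d} {R : realType} (P : probability T R)
  (n p : nat) (S : 'I_p -> set ('I_n -> R)) (A : midx n p -> T -> R) (c3 : R)
  : \bar R :=
  ((Num.sqrt n%:R)^-1)%:E *
    ((c3^-1)%:E * lne ('E_P[fun w => expR (c3 * phi S (fun i => A i w))])).

Definition xi_u {d} {T : measurableType d} {R : realType} (P : probability T R)
  (n p : nat) (S : 'I_p -> set ('I_n -> R)) (G : 'I_p -> 'I_n -> T -> R) (c3 : R)
  : \bar R :=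
  ((Num.sqrt n%:R)^-1)%:E *
    ((- (c3 / 2) * (p%:R - 1))%:E +
     (c3^-1)%:E * lne ('E_P[fun w => expR (c3 * phi_u S (fun j i => G j i w))])).

Definition xi_l {d} {T : measurableType d} {R : realType} (P : probability T R)
  (n p : nat) (S : 'I_p -> set ('I_n -> R)) (B : 'I_p -> midx n p -> T -> R)
  (c3 : R) : \bar R :=
  ((Num.sqrt n%:R)^-1)%:E *
    ((c3^-1)%:E * lne ('E_P[fun w => expR (c3 / Num.sqrt p%:R *
                                         phi_l S (fun j i => B j i w))])).

Definition all_index (n p : nat) : Type :=
  (midx n p + unit + ('I_p * 'I_n) + ('I_p * midx n p))%type.

Definition all_rv {d} {T : measurableType d} {R : realType} (n p : nat)
  (A : midx n p -> T -> R) (g : T -> R) (G : 'I_p -> 'I_n -> T -> R)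
  (B : 'I_p -> midx n p -> T -> R) (k : all_index n p) : T -> R :=
  match k with
  | inl (inl (inl i)) => A i
  | inl (inl (inr _)) => g
  | inl (inr (j, i)) => G j i
  | inr (j, i) => B j i
  end.

(* Main.v *)
Require Import Defs.
From HB Require Import structures.
From mathcomp Require Import all_boot all_order all_algebra.
From mathcomp Require Import all_classical all_reals all_analysis.
From mathcomp Require Import measurable_realfun.
From mathcomp Require Import ring lra.
Import Order.TTheory GRing.Theory Num.Theory.
Import numFieldNormedType.Exports.
Local Open Scope classical_set_scope.
Local Open Scope ring_scope.
Set Implicit Arguments. Unset Strict Implicit. Unset Printing Implicit Defensive.

(** Proof idea.  Both inequalities are instances of Slepian's comparison: if two
centred Gaussian processes have equal variances and the first one has the
larger covariances, then exp(c sup) has the smaller expectation for the first.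
For the upper bound one adds to the tensor form an independent Gaussian of
variance p - 1, which multiplies the exponential moment by exp(c^2 (p - 1) / 2),
and the covariances are compared by
  sum_j a_j <= prod_j a_j + p - 1  for  |a_j| <= 1;
the lower bound uses AM-GM, prod_j a_j <= (1/p) sum_j a_j^p, where p is even.

Slepian's comparison is proved by a Lindeberg replacement, without Gaussian
integration by parts.  A Gaussian vector is the product of commuting operators
f |-> E f(. + z l), one per direction l.  These are split into k^2 steps of
standard deviation 1/k by the semigroup property; exchanging one step costs the
second-order term, whose sign is given by the covariances, and an error
O(k^-3).  The test function is 1 / (1 + sum_s exp(u_s)), which approximates the
indicator of max_s u_s < 0, has bounded Lipschitz second derivatives, and has
nonnegative mixed second derivatives.  This compares the tails of maxima over
finitely many points, and a countable dense sequence gives the suprema. *)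

(** * Integrals against the normal law on the line *)

Section gaussian_line.
Context {R : realType}.
Local Notation mu := (@lebesgue_measure R).

Lemma integral_normal_prob (m s : R) (f : R -> \bar R) :
  measurable_fun setT f -> (forall x, 0 <= f x)%E ->
  (\int[normal_prob m s]_x f x = \int[mu]_x (f x * (normal_pdf m s x)%:E))%E.
Proof.
move=> mf f0.
rewrite -(Radon_Nikodym_SigmaFinite.change_of_variables
  (normal_prob_dominates m s))//=.
have RNi := Radon_Nikodym_SigmaFinite.f_integrable (normal_prob_dominates m s).
apply: ae_eq_integral => //.
- by apply: emeasurable_funM => //; exact: measurable_int RNi.
- apply: emeasurable_funM => //; apply/measurable_EFinP.
  exact: measurable_normal_pdf.
- apply: ae_eqe_mul2l; apply: integral_ae_eq => //.
  + by apply/measurable_EFinP; exact: measurable_normal_pdf.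
  + move=> E _ mE.
    by rewrite -(Radon_Nikodym_SigmaFinite.f_integral (normal_prob_dominates m
      s)).
Qed.

(* Completing the square in [z]: the joint density of the centred pair
   [(z, a z + b w)] is symmetric in its two arguments. *)
Lemma normal_pdf_swap (a b z x : R) : b != 0 -> a ^+ 2 + b ^+ 2 = 1 ->
  normal_pdf 0 1 z * normal_pdf (a * z) b x =
  normal_pdf 0 1 x * normal_pdf (a * x) b z.
Proof.
move=> b0 ab; rewrite !normal_pdfE ?oner_neq0// /normal_fun.
rewrite mulrACA [RHS]mulrACA; congr (_ * _); rewrite -!expRD; congr expR.
have -> : b ^+ 2 = 1 - a ^+ 2 by rewrite -ab; ring.
have : 1 - a ^+ 2 != 0 by rewrite -ab addrAC subrr add0r sqrf_eq0.
by move=> h; field.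
Qed.

Lemma integral_normal_affine (m b : R) (G : R -> R) : 0 < b -> continuous G ->
  (forall x, 0 <= G x) ->
  (\int[normal_prob 0 1]_w (G (m + b * w))%:E =
   \int[normal_prob m b]_x (G x)%:E)%E.
Proof.
move=> b0 cG G0.
have mG : measurable_fun setT G by exact: continuous_measurable_fun.
rewrite integral_normal_prob; last 2 first.
- apply/measurable_EFinP; apply: (measurableT_comp mG).
  by apply: measurable_funD => //; exact: measurable_funM.
- by move=> x; rewrite lee_fin.
rewrite integral_normal_prob; last 2 first.
- exact/measurable_EFinP.
- by move=> x; rewrite lee_fin.
(* The affine map is written as a translate times a positive constant, the shape in which its limits
   at both infinities are immediate. *)
pose F (x : R) := (x + m / b) * b.
have FE x : F x = m + b * x by rewrite /F mulrDl divfK ?gt_eqF// addrC mulrC.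
have dF (x : R) : is_derive x (1 : R) F b.
  rewrite /F; apply: is_derive_eq.
  by rewrite scaler0 add0r addr0 /GRing.scale /= mulr1.
have F'E : (F^`() = cst b)%classic.
  by apply/funext => x; rewrite derive1E; exact: derive_val.
pose H x := G x * normal_pdf m b x.
rewrite [RHS](_ : _ = \int[mu]_x (H x)%:E)%E; last first.
  by apply: eq_integral => x _; rewrite -EFinM.
rewrite (@increasing_ge0_integration_by_substitutionT R F H); first last.
- by move=> x; rewrite mulr_ge0// normal_pdf_ge0.
- move=> x; apply: continuousM; first exact: cG.
  by apply: continuous_normal_pdf; rewrite gt_eqF.
- by apply/gt0_cvgMly => //; exact: cvg_addrr.
- by apply/gt0_cvgMlNy => //; exact: cvg_addrr_Ny.
- by move=> x; exact: ex_derive.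
- by rewrite F'E; exact: is_cvg_cst.
- by rewrite F'E; exact: is_cvg_cst.
- by rewrite F'E => x; exact: cvg_cst.
- by move=> x y xy; rewrite !FE ltrD2l ltr_pM2l.
apply: eq_integral => x _; rewrite -EFinM F'E !fctE /H FE; congr EFin.
rewrite -[LHS]/(_ * _) -mulrA; congr (_ * _).
rewrite !normal_pdfE ?oner_neq0 ?gt_eqF// /normal_peak /normal_fun.
rewrite [RHS]mulrAC; congr (_ * expR _).
- rewrite expr1n mul1r -mulrnAr sqrtrM ?sqr_ge0// sqrtr_sqr gtr0_norm//.
  rewrite invfM mulrAC mulVf ?gt_eqF// mul1r //.
- have : b != 0 by rewrite gt_eqF.
  by move=> ?; field.
Qed.

(** Lebesgue measure is invariant under reflection and the centred density is even. *)
Lemma integral_normal_opp (f : R -> \bar R) :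
  measurable_fun setT f -> (forall x, 0 <= f x)%E ->
  (\int[normal_prob 0 1]_x f (- (x : R))%R = \int[normal_prob 0 1]_x f x)%E.
Proof.
move=> mf f0.
have mfN : measurable_fun setT (fun x : R => f (- x)%R).
  by apply: (measurableT_comp mf); exact: oppr_measurable.
rewrite !integral_normal_prob//.
have mg : measurable_fun setT (fun x : R => f x * (normal_pdf 0 1 x)%:E)%E.
  apply: emeasurable_funM => //; apply/measurable_EFinP.
  exact: measurable_normal_pdf.
rewrite [RHS](eq_measure_integral
    (pushforward mu (-%R : _ -> measurableTypeR R))); last first.
  by move=> A mA _; exact/esym/lebesgue_measureN.
have g0 (x : R) : (0 <= f x * (normal_pdf 0 1 x)%:E)%E.
  by rewrite mule_ge0// lee_fin normal_pdf_ge0.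
rewrite ge0_integral_pushforward; last 4 first.
- exact: oppr_measurable.
- exact: measurableT.
- exact: mg.
- by move=> x _; exact: g0.
rewrite preimage_setT; apply: eq_integral => x _ /=; congr (_ * _%:E)%E.
by rewrite !normal_pdfE ?oner_neq0// /normal_fun !subr0 sqrrN.
Qed.

(** Completing the square: [expR (c * x)] times the standard density is [expR (c ^+ 2 / 2)] times
    the density with mean [c], whose total mass is one. *)
Lemma integral_normal_expR (c : R) :
  (\int[normal_prob 0 1]_x (expR (c * (x : R)))%:E = (expR (c ^+ 2 / 2))%:E)%E.
Proof.
rewrite integral_normal_prob; last 2 first.
- apply/measurable_EFinP/measurableT_comp => //; exact: measurable_funM.
- by move=> x; rewrite lee_fin expR_ge0.
transitivity (\int[mu]_x ((expR (c ^+ 2 / 2))%:E * (normal_pdf c 1 x)%:E))%E.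
  apply: eq_integral => x _; rewrite -!EFinM; congr EFin.
  rewrite !normal_pdfE ?oner_neq0// mulrCA [RHS]mulrCA; congr (_ * _).
  by rewrite /normal_fun -!expRD; congr expR; field.
rewrite ge0_integralZl//.
- by rewrite integral_normal_pdf mule1.
- by apply/measurable_EFinP; exact: measurable_normal_pdf.
- by move=> x _; rewrite lee_fin normal_pdf_ge0.
Qed.

(** A single term of the exponential series is below the whole series. Summing over both signs
    removes the absolute value, so that integrability of all moments follows from the exponential
    moments. *)
Lemma normXn_le_expR (k : nat) (x : R) :
  `|x| ^+ k <= k`!%:R * (expR (1 * x) + expR (-1 * x)).
Proof.
have h : `|x| ^+ k <= k`!%:R * expR `|x|.
  case: k => [|k]; first by rewrite expr0 fact0 mul1r -expR0 ler_expR.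
  rewrite -ler_pdivrMl ?ltr0n ?fact_gt0// mulrC.
  by rewrite (le_trans _ (expR_ge1Dxn k (normr_ge0 x)))// lerDr.
apply: (le_trans h); rewrite ler_wpM2l// mul1r mulN1r.
by case: (ger0P x) => _; rewrite ?lerDl ?lerDr expR_ge0.
Qed.

Lemma integrable_normal_Xn (k : nat) :
  (normal_prob 0 1).-integrable setT (EFin \o (fun x : R => `|x| ^+ k)).
Proof.
apply: (@le_integrable _ _ _ (normal_prob 0 1) _ measurableT
  (EFin \o (fun x : R => `|x| ^+ k)) (fun x : R => (k`!%:R * (expR (1 * x) +
    expR (-1 * x)))%:E)).
- by apply/measurable_EFinP/measurable_funX; exact: normr_measurable.
- move=> x _; rewrite lee_fin ger0_norm ?exprn_ge0//.
  exact: le_trans (normXn_le_expR k x) (ler_norm _).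
- have h c : (normal_prob 0 1).-integrable setT (fun x : R => (expR (c *
    x))%:E).
    apply/integrableP; split.
      by apply/measurable_EFinP/measurableT_comp => //; exact: measurable_funM.
    under eq_integral do rewrite gee0_abs ?lee_fin ?expR_ge0//.
    by rewrite integral_normal_expR ltry.
  under eq_fun do rewrite EFinM EFinD.
  by apply: integrableZl => //; apply: integrableD => //; exact: h.
Qed.

Lemma integrable_normal_id :
  (normal_prob 0 1).-integrable setT (EFin \o (fun x : R => x)).
Proof.
apply: (@le_integrable _ _ _ (normal_prob 0 1) _ measurableT
  (EFin \o (fun x : R => x)) (EFin \o (fun x : R => `|x| ^+ 1))).
- exact/measurable_EFinP.
- by move=> x _; rewrite lee_fin expr1 normr_id.
- exact: integrable_normal_Xn.
Qed.

(** Reflection exchanges the positive and negative parts of the identity, so their integrals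
    cancel. *)
Lemma Rintegral_normal_id : \int[normal_prob 0 1]_x (x : R) = 0.
Proof.
rewrite /Rintegral integralE; set a := (X in (X - _)%E); set b := (X in (_ -
  X)%E).
suff <- : a = b.
  by case: a => [r| |]//=; rewrite subrr.
rewrite /a /b -integral_normal_opp; last 2 first.
- exact/measurable_funepos/measurable_EFinP.
- by move=> x; rewrite funepos_ge0.
apply: eq_integral => x _.
by rewrite funeposE funenegE.
Qed.

End gaussian_line.

(** * Real-valued integrals of bounded functions, with Fubini *)

Section bounded_Rintegral.
Context d (V : measurableType d) {R : realType} (mu : probability V R).
Implicit Types f g : V -> R.

Lemma bounded_integrable f (C : R) : measurable_fun setT f ->
  (forall x, `|f x| <= C) -> mu.-integrable setT (EFin \o f).
Proof.
move=> mf fC.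
apply: (@le_integrable _ _ _ mu _ measurableT (EFin \o f) (cst C%:E)).
- exact/measurable_EFinP.
- by move=> x _; rewrite lee_fin (le_trans (fC x))// ler_norm.
- exact: finite_measure_integrable_cst.
Qed.

Lemma EFin_Rintegral f : mu.-integrable setT (EFin \o f) ->
  (\int[mu]_x f x)%:E = (\int[mu]_x (f x)%:E)%E.
Proof. by move=> fi; rewrite /Rintegral fineK//; exact: integrable_fin_num. Qed.

Lemma Rintegral_prob_cst (c : R) : \int[mu]_x c = c.
Proof.
rewrite Rintegral_cst// -[RHS]mulr1; congr (_ * _).
by rewrite -[RHS]/(fine 1%E); congr fine; exact: probability_setT.
Qed.

Lemma le_norm_Rintegral f (C : R) : mu.-integrable setT (EFin \o f) ->
  (forall x, `|f x| <= C) -> `|\int[mu]_x f x| <= C.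
Proof.
move=> fi fC; apply: (le_trans (le_normr_Rintegral measurableT fi)).
rewrite -[leRHS]Rintegral_prob_cst; apply: le_Rintegral => //.
- exact: integrable_norm.
- exact: finite_measure_integrable_cst.
Qed.

End bounded_Rintegral.

(** Adding the bound [C] makes the function nonnegative, so Tonelli gives the measurability of the
    partial integral; the constant is subtracted afterwards. *)
Lemma measurable_Rintegral2 d1 d2 (V1 : measurableType d1)
    (V2 : measurableType d2) {R : realType} (m2 : probability V2 R)
    (f : V1 * V2 -> R) (C : R) :
  measurable_fun setT f -> (forall x, `|f x| <= C) ->
  measurable_fun setT (fun x => \int[m2]_y f (x, y)).
Proof.
move=> mf fC; pose g z := (f z + C)%:E.
have g0 z : (0 <= g z)%E.
  by rewrite lee_fin -lerBlDr sub0r; move: (fC z); rewrite ler_norml => /andP[].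
have mg : measurable_fun setT g by apply/measurable_EFinP/measurable_funD.
have intf x : m2.-integrable setT (EFin \o (fun y => f (x, y))).
  apply: (bounded_integrable m2 (C := C)) => //.
  exact: measurable_fun_pair2.
have intC : m2.-integrable setT (EFin \o (fun=> C)).
  exact: finite_measure_integrable_cst.
rewrite (_ : (fun x => _) = fun x => fine (fubini_F m2 g x) - C).
  apply: measurable_funB => //.
  apply: (measurableT_comp (fine_measurable measurableT)).
  exact: measurable_fun_fubini_tonelli_F.
apply/funext => x; apply/eqP; rewrite -subr_eq opprK; apply/eqP.
by rewrite -[X in _ + X = _](Rintegral_prob_cst m2) -RintegralD.
Qed.

Section bounded_Fubini.
Context d1 d2 (V1 : measurableType d1) (V2 : measurableType d2) {R : realType}.
Variables (m1 : probability V1 R) (m2 : probability V2 R).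
Variables (f : V1 * V2 -> R) (C : R).
Hypotheses (mf : measurable_fun setT f) (fC : forall x, `|f x| <= C).

Let intf : (m1 \x m2)%E.-integrable setT (EFin \o f).
Proof. exact: bounded_integrable fC. Qed.

Let intf2 x : m2.-integrable setT (EFin \o (fun y => f (x, y))).
Proof.
by apply: (@bounded_integrable _ _ _ _ _ C) => //; exact: measurable_fun_pair2.
Qed.

Let intf1 y : m1.-integrable setT (EFin \o (fun x => f (x, y))).
Proof.
by apply: (@bounded_integrable _ _ _ _ _ C) => //; exact: measurable_fun_pair1.
Qed.

Lemma Rintegral12 : \int[m1]_x \int[m2]_y f (x, y) = \int[(m1 \x m2)%E]_z f z.
Proof.
rewrite [RHS]/Rintegral -integral12_prod_meas1//; congr fine.
by apply: eq_integral => x _; rewrite EFin_Rintegral.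
Qed.

Lemma Rintegral_swap :
  \int[m1]_x \int[m2]_y f (x, y) = \int[m2]_y \int[m1]_x f (x, y).
Proof.
rewrite Rintegral12 /Rintegral -integral21_prod_meas1//; congr fine.
by apply: eq_integral => x _; rewrite EFin_Rintegral.
Qed.

End bounded_Fubini.

(** * Stability of the normal law under normalised sums *)

Section gaussian_convolution.
Context {R : realType}.
Local Notation mu := (@lebesgue_measure R).
Local Notation gauss := (@normal_prob R 0 1).

(** Given [z], the point [a * z + b * w] is normal with mean [a * z] and deviation [b]. The symmetry
    [normal_pdf_swap] of the joint density and Tonelli let [z] be integrated first, and its
    conditional density has mass one. *)
Lemma ge0_normal_convolution (a b : R) (G : R -> R) : 0 < b ->
  a ^+ 2 + b ^+ 2 = 1 -> continuous G -> (forall x, 0 <= G x) ->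
  (\int[gauss]_z \int[gauss]_w (G (a * z + b * w))%:E =
   \int[gauss]_x (G x)%:E)%E.
Proof.
move=> b0 ab cG G0; have bn0 : b != 0 by rewrite gt_eqF.
have mG : measurable_fun setT G by exact: continuous_measurable_fun.
pose H (zx : R * R) : \bar R :=
  (G zx.2 * (normal_pdf 0 1 zx.2 * normal_pdf (a * zx.2) b zx.1))%:E.
have H0 zx : (0 <= H zx)%E by rewrite lee_fin !mulr_ge0// normal_pdf_ge0.
have mH : measurable_fun setT H.
  apply/measurable_EFinP; apply: measurable_funM.
    exact: (measurableT_comp mG).
  apply: measurable_funM.
    exact: (measurableT_comp (measurable_normal_pdf _ _)).
  (* Moving the varying mean into the argument leaves one fixed density composed with a linear map,
     hence joint measurability. *)
  rewrite (_ : (fun _ => _) = fun zx : R * R => normal_pdf 0 b (zx.1 - a *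
    zx.2)).
    apply: (measurableT_comp (measurable_normal_pdf _ _)).
    by apply: measurable_funB => //; exact: measurable_funM.
  by apply/funext => zx; rewrite !normal_pdfE// /normal_fun subr0.
transitivity (\int[gauss]_z \int[mu]_x
    (G x * normal_pdf (a * z) b x)%:E)%E.
  apply: eq_integral => z _; rewrite integral_normal_affine//.
  by rewrite integral_normal_prob//; exact/measurable_EFinP.
have pdf_neq0 z : normal_pdf 0 1 z != 0 :> R.
  rewrite normal_pdfE ?oner_neq0// mulf_neq0//.
    by rewrite gt_eqF// normal_peak_gt0// oner_neq0.
  by rewrite gt_eqF// expR_gt0.
have HE z x : ((G x * normal_pdf (a * z) b x)%:E * (normal_pdf 0 1 z)%:E =
    H (z, x))%E.
  by rewrite -EFinM /H /= -(normal_pdf_swap z x bn0 ab); congr EFin; ring.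
rewrite integral_normal_prob; last 2 first.
(* The inner integral is recovered from that of [H] by dividing by the nonvanishing density of [z];
   Tonelli then gives its measurability. *)
- rewrite (_ : (fun _ => _) = fun z : R =>
      ((normal_pdf 0 1 z)^-1%:E * \int[mu]_x H (z, x))%E); last first.
    apply/funext => z; rewrite -ge0_integralZl//.
    + apply: eq_integral => x _; rewrite -HE -!EFinM; congr EFin.
      by rewrite mulrCA mulVf ?mulr1.
    + exact: (measurableT_comp mH).
    + by rewrite lee_fin invr_ge0 normal_pdf_ge0.
  apply: emeasurable_funM.
    apply/measurable_EFinP; apply: continuous_measurable_fun => z.
    by apply: continuousV => //; apply: continuous_normal_pdf; rewrite
      oner_neq0.
  exact: (@measurable_fun_fubini_tonelli_F _ _ (measurableTypeR R)
    (measurableTypeR R) R mu H mH H0).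
- by move=> z; apply: integral_ge0 => x _; rewrite lee_fin mulr_ge0//
    normal_pdf_ge0.
transitivity (\int[mu]_z \int[mu]_x H (z, x))%E.
  apply: eq_integral => z _; rewrite muleC.
  have pdf0 : (0 <= (normal_pdf 0 1 z)%:E)%E by rewrite lee_fin normal_pdf_ge0.
  have Gpdf0 x : (0 <= (G x * normal_pdf (a * z) b x)%:E)%E.
    by rewrite lee_fin mulr_ge0// normal_pdf_ge0.
  have mGpdf : measurable_fun setT
      (fun x => (G x * normal_pdf (a * z) b x)%:E).
    apply/measurable_EFinP; apply: measurable_funM => //.
    exact: measurable_normal_pdf.
  rewrite -(ge0_integralZl mu measurableT mGpdf (fun x _ => Gpdf0 x) pdf0).
  by apply: eq_integral => x _; rewrite muleC HE.
transitivity (\int[mu]_x \int[mu]_z H (z, x))%E.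
  exact: (@fubini_tonelli _ _ (measurableTypeR R) (measurableTypeR R) R mu mu
    H mH H0).
rewrite integral_normal_prob//; last first.
  exact/measurable_EFinP.
apply: eq_integral => x _; rewrite /H /=.
under eq_integral do rewrite mulrA EFinM.
rewrite ge0_integralZl//.
- by rewrite integral_normal_pdf mule1.
- by apply/measurable_EFinP; exact: measurable_normal_pdf.
- by move=> y _; rewrite lee_fin normal_pdf_ge0.
- by rewrite lee_fin mulr_ge0// normal_pdf_ge0.
Qed.

(** Reduces to the nonnegative case applied to [G + C]. *)
Lemma normal_convolution (a b C : R) (G : R -> R) : 0 < b ->
  a ^+ 2 + b ^+ 2 = 1 -> continuous G -> (forall x, `|G x| <= C) ->
  \int[gauss]_z \int[gauss]_w G (a * z + b * w) = \int[gauss]_x G x.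
Proof.
move=> b0 ab cG GC.
have mG : measurable_fun setT G by exact: continuous_measurable_fun.
have mGz z : measurable_fun setT (fun w : R => G (a * z + b * w)).
  by apply: (measurableT_comp mG); apply: measurable_funD.
have mG2 : measurable_fun setT (fun zw : R * R => G (a * zw.1 + b * zw.2)).
  by apply: (measurableT_comp mG); apply: measurable_funD; exact:
    measurable_funM.
have mI : measurable_fun setT (fun z : R => \int[gauss]_w G (a * z + b * w)).
  exact: (measurable_Rintegral2 gauss mG2 (fun zw => GC _)).
have iG : gauss.-integrable setT (EFin \o G).
  exact: (bounded_integrable gauss mG GC).
have iGz z : gauss.-integrable setT (EFin \o (fun w : R => G (a * z + b * w))).
  exact: (bounded_integrable gauss (mGz z) (fun w => GC _)).
have iI : gauss.-integrable setT
    (EFin \o (fun z : R => \int[gauss]_w G (a * z + b * w))).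
  apply: (bounded_integrable gauss mI (C := C)) => z.
  exact: (le_norm_Rintegral (iGz z) (fun w => GC _)).
have ic : gauss.-integrable setT (EFin \o (fun _ : R => C)).
  exact: finite_measure_integrable_cst.
apply: (addIr C).
rewrite -{1}(Rintegral_prob_cst gauss C) -RintegralD//.
rewrite -[X in _ = _ + X](Rintegral_prob_cst gauss C) -RintegralD//.
apply: EFin_inj; rewrite !EFin_Rintegral; last 2 first.
- exact: (integrableD measurableT iG ic).
- exact: (integrableD measurableT iI ic).
rewrite -(@ge0_normal_convolution a b (fun x => G x + C))//; last 2 first.
- by move=> x; apply: continuousD; [exact: cG|exact: cst_continuous].
- by move=> x; rewrite -lerBlDr sub0r; move: (GC x); rewrite ler_norml =>
    /andP[].
apply: eq_integral => z _.
rewrite -[X in (_ + X)%:E](Rintegral_prob_cst gauss C) -RintegralD//.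
by rewrite EFin_Rintegral//; exact: (integrableD measurableT (iGz z) ic).
Qed.

End gaussian_convolution.

(** * Gaussian smoothing operators and their commuting semigroups *)

Section gaussian_operator.
Context {R : realType} {m : nat}.
Local Notation gauss := (@normal_prob R 0 1).
Implicit Types (u v l : 'I_m -> R) (f g : ('I_m -> R) -> R).

Definition dist1 u v : R := \sum_(s < m) `|u s - v s|.

(* The test functions.  Measurability is asked after composition with every
   family of real random variables, so that it passes to partial integrals
   without a measurable structure on ['I_m -> R]. *)
Record nice f : Prop := Nice {
  nice_bounded : exists C : R, forall u, `|f u| <= C;
  nice_lipschitz : exists2 L : R, 0 <= L & forall u v, `|f u - f v| <= L *
    dist1 u v;
  nice_measurable : forall d (V : measurableType d) (c : 'I_m -> V -> R),
    (forall s, measurable_fun setT (c s)) ->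
    measurable_fun setT (fun x => f (fun s => c s x)) }.

Definition shift u (z : R) l : 'I_m -> R := fun s => u s + z * l s.

Definition gauss_op l f u : R := \int[gauss]_z f (shift u z l).

Definition gauss_ops (ls : seq ('I_m -> R)) f := foldr gauss_op f ls.

Definition scale_dir (e : R) l : 'I_m -> R := fun s => e * l s.

Lemma dist1_ge0 u v : 0 <= dist1 u v.
Proof. by apply: sumr_ge0. Qed.

Lemma dist1_shift u v z l : dist1 (shift u z l) (shift v z l) = dist1 u v.
Proof.
by apply: eq_bigr => s _; congr (`|_|); rewrite /shift; ring.
Qed.

Lemma dist1_shiftl u z l : dist1 (shift u z l) u = `|z| * \sum_(s < m) `|l s|.
Proof.
by rewrite mulr_sumr; apply: eq_bigr => s _; rewrite addrC addKr normrM.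
Qed.

Lemma nice_cst (c : R) : nice (fun=> c).
Proof.
split; [by exists `|c| | | by move=> *; exact: measurable_cst].
by exists 0 => // u v; rewrite subrr normr0 mul0r.
Qed.

Lemma niceD f g : nice f -> nice g -> nice (fun u => f u + g u).
Proof.
move=> [[C fC] [L L0 fL] fm] [[D gD] [M M0 gM] gm]; split.
- by exists (C + D) => u; rewrite (le_trans (ler_normD _ _))// lerD.
- exists (L + M) => [|u v]; first exact: addr_ge0.
  by rewrite opprD addrACA mulrDl (le_trans (ler_normD _ _))// lerD.
- by move=> d V c mc; apply: measurable_funD; [exact: fm|exact: gm].
Qed.

Lemma niceM f g : nice f -> nice g -> nice (fun u => f u * g u).
Proof.
move=> [[C fC] [L L0 fL] fm] [[D gD] [M M0 gM] gm]; split.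
- exists (C * D) => u; rewrite normrM ler_pM//.
- have C0 : 0 <= C by rewrite (le_trans _ (fC (fun=> 0))).
  have D0 : 0 <= D by rewrite (le_trans _ (gD (fun=> 0))).
  exists (L * D + C * M) => [|u v]; first by rewrite addr_ge0// mulr_ge0.
  have -> : f u * g u - f v * g v = (f u - f v) * g u + f v * (g u - g v).
    by ring.
  rewrite [leRHS]mulrDl (le_trans (ler_normD _ _))// lerD// normrM.
    by rewrite mulrAC ler_pM.
  by rewrite -mulrA ler_pM.
- by move=> d V c mc; apply: measurable_funM; [exact: fm|exact: gm].
Qed.

Lemma nice_sum (I : Type) (r : seq I) (F : I -> ('I_m -> R) -> R) :
  (forall i, nice (F i)) -> nice (fun u => \sum_(i <- r) F i u).
Proof.
move=> nF; elim: r => [|i r ih].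
  rewrite (_ : (fun _ => _) = fun=> 0); first exact: nice_cst.
  by apply/funext => u; rewrite big_nil.
rewrite (_ : (fun _ => _) = fun u => F i u + \sum_(j <- r) F j u).
  exact: niceD.
by apply/funext => u; rewrite big_cons.
Qed.

Lemma niceZ (c : R) f : nice f -> nice (fun u => c * f u).
Proof. by apply: niceM; exact: nice_cst. Qed.

Lemma nice_line f u l : nice f -> measurable_fun setT (fun z : R => f (shift u
  z l)).
Proof.
move=> nf; apply: (nice_measurable nf (V := measurableTypeR R)
  (c := fun s z => u s + z * l s)) => s.
by apply: measurable_funD => //; exact: measurable_funM.
Qed.

Lemma nice_line_integrable f u l : nice f ->
  gauss.-integrable setT (EFin \o (fun z : R => f (shift u z l))).
Proof.
move=> nf; have [C fC] := nice_bounded nf.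
exact: (bounded_integrable gauss (nice_line u l nf) (fun z => fC _)).
Qed.

Lemma nice_line_continuous f u l : nice f -> continuous (fun z : R => f (shift
  u z l)).
Proof.
move=> nf z; have [L L0 fL] := nice_lipschitz nf.
pose S := \sum_(s < m) `|l s|.
have S0 : 0 <= S by apply: sumr_ge0.
apply/cvgrPdist_le => e e0; near=> y.
apply: (le_trans (fL _ _)).
have -> : dist1 (shift u z l) (shift u y l) = `|z - y| * S.
  rewrite mulr_sumr; apply: eq_bigr => s _.
  by rewrite -normrM; congr (`|_|); rewrite /shift; ring.
have : `|z - y| <= e / (L * S + 1).
  near: y; apply: cvgr_dist_le; first exact: cvg_id.
  by rewrite divr_gt0// ltr_wpDl// mulr_ge0.
have LS : 0 < L * S + 1 by rewrite ltr_wpDl// mulr_ge0.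
rewrite ler_pdivlMr// => h; apply: le_trans h.
by rewrite mulrCA ler_wpM2l// lerDl.
Unshelve. all: by end_near. Qed.

Lemma nice_gauss_op l f : nice f -> nice (gauss_op l f).
Proof.
move=> nf; have [[C fC] [L L0 fL] fm] := nf; split.
- exists C => u; apply: (le_norm_Rintegral (nice_line_integrable u l nf)) => z.
  exact: fC.
- exists L => // u v; rewrite /gauss_op -RintegralB//;
    [|exact: nice_line_integrable..].
  apply: le_norm_Rintegral => [|z]; last by rewrite -(dist1_shift u v z l).
  exact: (integrableB measurableT (nice_line_integrable u l nf)
    (nice_line_integrable v l nf)).
- move=> d V c mc.
  have mf : measurable_fun setT
      (fun x : V * measurableTypeR R => f (shift (fun s => c s x.1) x.2 l)).
    apply: (fm _ [the measurableType _ of (V * measurableTypeR R)%type]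
      (fun s x => c s x.1 + x.2 * l s)) => s.
    apply: measurable_funD; first exact: (measurableT_comp (mc s)).
    exact: measurable_funM.
  exact: (measurable_Rintegral2 gauss mf (fun x => fC _)).
Qed.

Lemma gauss_op_cst l c : gauss_op l (fun=> c) = fun=> c.
Proof. by apply/funext => u; exact: (Rintegral_prob_cst gauss). Qed.

Lemma gauss_opD l f g : nice f -> nice g ->
  gauss_op l (fun u => f u + g u) = fun u => gauss_op l f u + gauss_op l g u.
Proof.
by move=> nf ng; apply/funext => u; apply: RintegralD => //;
  exact: nice_line_integrable.
Qed.

Lemma gauss_opZ l c f : nice f ->
  gauss_op l (fun u => c * f u) = fun u => c * gauss_op l f u.
Proof.
by move=> nf; apply/funext => u; apply: RintegralZl => //;
  exact: nice_line_integrable.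
Qed.

Lemma le_gauss_op l f g : nice f -> nice g -> (forall u, f u <= g u) ->
  forall u, gauss_op l f u <= gauss_op l g u.
Proof.
by move=> nf ng fg u; apply: le_Rintegral => //; exact: nice_line_integrable.
Qed.

(** Translations commute, and Fubini exchanges the two integrals. *)
Lemma gauss_opC k l f : nice f ->
  gauss_op k (gauss_op l f) = gauss_op l (gauss_op k f).
Proof.
move=> nf; have [C fC] := nice_bounded nf; apply/funext => u.
pose h (zw : measurableTypeR R * measurableTypeR R) :=
  f (shift (shift u zw.1 k) zw.2 l).
have mh : measurable_fun setT h.
  apply: (nice_measurable nf
    (V := [the measurableType _ of (measurableTypeR R * measurableTypeR
      R)%type])
    (c := fun s zw => u s + zw.1 * k s + zw.2 * l s)) => s.
  by apply: measurable_funD; [apply: measurable_funD|]; rewrite //;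
    exact: measurable_funM.
have := Rintegral_swap gauss gauss mh (fun x => fC _).
rewrite /gauss_op => ->; apply: eq_Rintegral => z _; apply: eq_Rintegral => w _.
by rewrite /h; congr f; apply/funext => s; rewrite /shift/=; ring.
Qed.

Lemma gauss_op0 f : gauss_op (fun=> 0) f = f.
Proof.
apply/funext => u; rewrite -[RHS](Rintegral_prob_cst gauss).
apply: eq_Rintegral => z _; congr f; apply/funext => s.
by rewrite /shift mulr0 addr0.
Qed.

(** Variances of independent Gaussians add: along [l], dividing by [c] puts [(a / c, b / c)] on the
    unit circle, where [normal_convolution] applies. *)
Lemma gauss_op_semigroup (a b c : R) l f : nice f -> 0 < b -> 0 <= a -> 0 <= c
  ->
  a ^+ 2 + b ^+ 2 = c ^+ 2 ->
  gauss_op (scale_dir a l) (gauss_op (scale_dir b l) f) =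
  gauss_op (scale_dir c l) f.
Proof.
move=> nf b0 a0 c0 abc; have [C fC] := nice_bounded nf; apply/funext => u.
have cgt0 : 0 < c.
  rewrite lt_neqAle c0 andbT eq_sym -sqrf_eq0 -abc gt_eqF//.
  by rewrite ltr_wpDl ?sqr_ge0// exprn_gt0.
have cn0 : c != 0 by rewrite gt_eqF.
have := @normal_convolution R (a / c) (b / c) C
  (fun x => f (shift u x (scale_dir c l))).
rewrite /gauss_op => <-.
- apply: eq_Rintegral => z _; apply: eq_Rintegral => w _; congr f.
  by apply/funext => s; rewrite /shift /scale_dir; field.
- by rewrite divr_gt0.
- by rewrite !expr_div_n -mulrDl abc divff// sqrf_eq0.
- exact: nice_line_continuous.
- by move=> x; exact: fC.
Qed.

Lemma nice_gauss_ops ls f : nice f -> nice (gauss_ops ls f).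
Proof. by move=> nf; elim: ls => //= l ls; exact: nice_gauss_op. Qed.

Lemma gauss_ops_op l ls f : nice f ->
  gauss_ops ls (gauss_op l f) = gauss_op l (gauss_ops ls f).
Proof.
move=> nf; elim: ls => //= k ls ->.
by apply: gauss_opC; exact: nice_gauss_ops.
Qed.

Lemma gauss_opsC ks ls f : nice f ->
  gauss_ops ks (gauss_ops ls f) = gauss_ops ls (gauss_ops ks f).
Proof.
move=> nf; elim: ks => //= k ks ->.
by rewrite gauss_ops_op//; exact: nice_gauss_ops.
Qed.

Lemma gauss_opsDcst ls f c : nice f ->
  gauss_ops ls (fun u => f u + c) = fun u => gauss_ops ls f u + c.
Proof.
move=> nf; elim: ls => //= l ls ->.
rewrite (gauss_opD l (nice_gauss_ops ls nf) (nice_cst c)).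
by rewrite gauss_op_cst.
Qed.

Lemma le_gauss_ops ls f g : nice f -> nice g -> (forall u, f u <= g u) ->
  forall u, gauss_ops ls f u <= gauss_ops ls g u.
Proof.
move=> nf ng fg; elim: ls => //= l ls ih.
by apply: le_gauss_op => //; exact: nice_gauss_ops.
Qed.

(** The heat semigroup at time [e ^+ 2], generated by half the sum of the second derivatives along
    [ls]. *)
Definition scaled_ops (e : R) ls := gauss_ops (map (scale_dir e) ls).

Lemma scaled_ops0 ls f : scaled_ops 0 ls f = f.
Proof.
elim: ls => //= l ls; rewrite /scaled_ops /= => ->.
rewrite (_ : scale_dir 0 l = fun=> 0) ?gauss_op0//.
by apply/funext => s; rewrite /scale_dir mul0r.
Qed.

Lemma scaled_ops1 ls f : scaled_ops 1 ls f = gauss_ops ls f.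
Proof.
rewrite /scaled_ops (_ : map _ ls = ls)// -[RHS]map_id; apply: eq_map => l.
by apply/funext => s; rewrite /scale_dir mul1r.
Qed.

Lemma scaled_ops_semigroup (a b c : R) ls f : nice f -> 0 < b -> 0 <= a ->
  0 <= c -> a ^+ 2 + b ^+ 2 = c ^+ 2 ->
  scaled_ops a ls (scaled_ops b ls f) = scaled_ops c ls f.
Proof.
move=> nf b0 a0 c0 abc; rewrite /scaled_ops; elim: ls => //= l ls ih.
rewrite gauss_ops_op; last exact: nice_gauss_ops.
by rewrite ih (gauss_op_semigroup l _ b0 a0 c0 abc)//; exact: nice_gauss_ops.
Qed.

End gaussian_operator.

(** * Second-order expansion and Lindeberg replacement *)

Section lindeberg.
Context {R : realType} {m : nat}.
Local Notation gauss := (@normal_prob R 0 1).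
Implicit Types (u v l : 'I_m -> R) (f g : ('I_m -> R) -> R).

Lemma le_dist_gauss_op l f g (e : R) u : nice f -> nice g ->
  (forall u, `|f u - g u| <= e) -> `|gauss_op l f u - gauss_op l g u| <= e.
Proof.
move=> nf ng fg; rewrite /gauss_op -RintegralB//; [|exact:
  nice_line_integrable..].
apply: le_norm_Rintegral => [|z]; last exact: fg.
exact: (integrableB measurableT (nice_line_integrable u l nf)
  (nice_line_integrable u l ng)).
Qed.

Lemma shift_scale u z e l : shift u z (scale_dir e l) = shift u (e * z) l.
Proof. by apply/funext => s; rewrite /shift /scale_dir mulrA (mulrC z). Qed.

(** The displacement [e * z] along [l] costs the Lipschitz constant of [f] times the first absolute
    moment of [z]. *)
Lemma gauss_op_lipschitz l f : nice f -> exists2 C : R, 0 <= C &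
  forall (e : R) u, 0 <= e -> `|gauss_op (scale_dir e l) f u - f u| <= C * e.
Proof.
move=> nf; have [L L0 fL] := nice_lipschitz nf.
have iz : gauss.-integrable setT (EFin \o (fun z : R => `|z| ^+ 1)).
  exact: integrable_normal_Xn.
exists (L * (\sum_(s < m) `|l s|) * \int[gauss]_z `|z : R| ^+ 1) => [|e u e0].
  by rewrite !mulr_ge0// ?sumr_ge0//; apply: Rintegral_ge0.
have icst : gauss.-integrable setT (EFin \o (fun _ : R => f u)).
  exact: finite_measure_integrable_cst.
rewrite -[X in `|_ - X|](Rintegral_prob_cst gauss) /gauss_op -RintegralB//;
  last exact: nice_line_integrable.
have iB : gauss.-integrable setT
    (EFin \o (fun z : R => f (shift u z (scale_dir e l)) - f u)).
  exact: (integrableB measurableT (nice_line_integrable u _ nf) icst).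
apply: (le_trans (le_normr_Rintegral measurableT iB)).
have i2 : gauss.-integrable setT (EFin \o (fun z : R =>
    L * (\sum_(s < m) `|l s|) * e * `|z| ^+ 1)).
  exact: (integrableZl measurableT _ iz).
rewrite [leRHS]mulrAC -RintegralZl//; apply: le_Rintegral => //.
  exact: integrable_norm.
move=> z _; rewrite shift_scale (le_trans (fL _ _))// dist1_shiftl.
rewrite normrM (ger0_norm e0) expr1 le_eqVlt; apply/orP; left; apply/eqP.
by ring.
Qed.

(** [D l] and [G l] stand for the first and second derivatives of [F] along [l]; they are tied to
    [F] by a Taylor bound with uniform cubic remainder. *)
Variables (F : ('I_m -> R) -> R) (D G : ('I_m -> R) -> ('I_m -> R) -> R).
Hypothesis nF : nice F.
Hypothesis nG : forall l, nice (G l).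
Hypothesis taylorF : forall l, exists2 C : R, 0 <= C & forall u z,
  `|F (shift u z l) - (F u + z * D l u + z ^+ 2 / 2 * G l u)| <= C * `|z| ^+ 3.

(* Half the second moment; its value cancels in [gauss_ops_compare]. *)
Let kappa : R := \int[gauss]_z (`|z : R| ^+ 2 / 2).

Let kappa_ge0 : 0 <= kappa.
Proof. by apply: Rintegral_ge0 => z _; rewrite divr_ge0// exprn_ge0. Qed.

Let ikappa : gauss.-integrable setT (EFin \o (fun z : R => `|z| ^+ 2 / 2)).
Proof.
exact: (integrableZr measurableT _ (integrable_normal_Xn 2)).
Qed.

(** The Taylor bound is integrated in [z]: the linear term vanishes because the mean is zero, and
    the remainder is controlled by the third absolute moment. *)
Lemma gauss_op_expansion l : exists2 C : R, 0 <= C & forall (e : R) u, 0 <= e ->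
  `|gauss_op (scale_dir e l) F u - (F u + e ^+ 2 * kappa * G l u)| <= C * e ^+
    3.
Proof.
have [C C0 FC] := taylorF l.
have i3 := @integrable_normal_Xn R 3.
exists (C * \int[gauss]_z `|z : R| ^+ 3) => [|e u e0].
  by rewrite mulr_ge0//; apply: Rintegral_ge0 => z _; rewrite exprn_ge0.
have ic : gauss.-integrable setT (EFin \o (fun _ : R => F u)).
  exact: finite_measure_integrable_cst.
have i1 : gauss.-integrable setT (EFin \o (fun z : R => z * (e * D l u))).
  exact: (integrableZr measurableT _ integrable_normal_id).
have i2 : gauss.-integrable setT
    (EFin \o (fun z : R => `|z| ^+ 2 / 2 * (e ^+ 2 * G l u))).
  exact: (integrableZr measurableT _ ikappa).
have ic1 := integrableD measurableT ic i1.
have ic12 := integrableD measurableT ic1 i2.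
have iF := nice_line_integrable u (scale_dir e l) nF.
have -> : F u + e ^+ 2 * kappa * G l u = \int[gauss]_z
    (F u + (z : R) * (e * D l u) + `|z| ^+ 2 / 2 * (e ^+ 2 * G l u)).
  rewrite RintegralD// RintegralD// (Rintegral_prob_cst gauss).
  rewrite RintegralZr//; last exact: integrable_normal_id.
  rewrite Rintegral_normal_id mul0r addr0 RintegralZr// -/kappa.
  by congr (_ + _); ring.
rewrite /gauss_op -RintegralB//.
have iB : gauss.-integrable setT (EFin \o (fun z : R =>
    F (shift u z (scale_dir e l)) -
    (F u + z * (e * D l u) + `|z| ^+ 2 / 2 * (e ^+ 2 * G l u)))).
  exact: (integrableB measurableT iF ic12).
apply: (le_trans (le_normr_Rintegral measurableT iB)).
have i4 : gauss.-integrable setT (EFin \o (fun z : R => C * e ^+ 3 * `|z| ^+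
  3)).
  exact: (integrableZl measurableT _ i3).
rewrite [leRHS]mulrAC -RintegralZl//; apply: le_Rintegral => //.
  exact: (integrable_norm iB).
move=> z _; rewrite shift_scale.
have <- : C * `|e * z| ^+ 3 = C * e ^+ 3 * `|z| ^+ 3.
  by rewrite normrM (ger0_norm e0); ring.
apply: le_trans (FC u (e * z)); rewrite le_eqVlt; apply/orP; left; apply/eqP.
by congr (`|_|); rewrite real_normK ?num_real//; field.
Qed.

(** Induction on the directions. Smoothing the second-order term once more changes it by [e ^+ 2]
    times a Lipschitz error of order [e], which is again of order [e ^+ 3]. *)
Lemma scaled_ops_expansion ls : exists2 C : R, 0 <= C & forall (e : R) u, 0 <=
  e ->
  `|scaled_ops e ls F u - (F u + e ^+ 2 * kappa * \sum_(l <- ls) G l u)|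
    <= C * e ^+ 3.
Proof.
elim: ls => [|l ls [C1 C10 h1]].
  by exists 0 => // e u e0; rewrite big_nil mulr0 addr0 subrr normr0 mul0r.
have [C2 C20 h2] := gauss_op_expansion l.
have nS := nice_sum ls nG.
have [C3 C30 h3] := gauss_op_lipschitz l nS.
exists (C1 + C2 + kappa * C3) => [|e u e0].
  by rewrite !addr_ge0// mulr_ge0.
pose S v := \sum_(k <- ls) G k v.
have nKS : nice (fun v => e ^+ 2 * kappa * S v) by exact: niceZ.
have := le_dist_gauss_op (scale_dir e l) u
  (nice_gauss_ops (map (scale_dir e) ls) nF) (niceD nF nKS) (h1 e ^~ e0).
rewrite (gauss_opD _ nF nKS) (gauss_opZ _ _ nS) -/S.
have := h2 e u e0; have := h3 e u e0; rewrite -/(S u) big_cons -/(S u).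
rewrite /scaled_ops /= -/(scaled_ops e ls F).
set a := gauss_op _ S u; set b := gauss_op _ F u; set c := gauss_op _ _ u.
move=> q3 q2 q1.
have -> : c - (F u + e ^+ 2 * kappa * (G l u + S u)) =
  (c - (b + e ^+ 2 * kappa * a)) + (b - (F u + e ^+ 2 * kappa * G l u))
  + e ^+ 2 * kappa * (a - S u) by ring.
apply: (le_trans (ler_normD _ _)); rewrite mulrDl lerD//.
  by apply: (le_trans (ler_normD _ _)); rewrite mulrDl lerD.
rewrite normrM ger0_norm ?mulr_ge0 ?sqr_ge0//.
apply: (le_trans (ler_wpM2l _ q3)); first by rewrite mulr_ge0 ?sqr_ge0.
by rewrite le_eqVlt; apply/orP; left; apply/eqP; ring.
Qed.

(** A telescoping argument: steps of deviation [1 / k] along [ms] are exchanged one by one for steps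
    along [ls]. Each exchange is favourable up to [C / k ^ 3], and there are [k ^ 2] of them. *)
Lemma gauss_ops_compare ls ms :
  (forall u, \sum_(l <- ms) G l u <= \sum_(l <- ls) G l u) ->
  forall u, gauss_ops ms F u <= gauss_ops ls F u.
Proof.
move=> GG u.
have [C [C0 hC]] : exists C : R, 0 <= C /\ forall (e : R) u, 0 <= e ->
    scaled_ops e ms F u <= scaled_ops e ls F u + C * e ^+ 3.
  have [C1 C10 h1] := scaled_ops_expansion ls.
  have [C2 C20 h2] := scaled_ops_expansion ms.
  exists (C1 + C2); split; first exact: addr_ge0.
  move=> e v e0; have := h1 e v e0; have := h2 e v e0.
  rewrite !ler_norml => /andP[_ q2] /andP[q1 _].
  have : e ^+ 2 * kappa * \sum_(l <- ms) G l v <=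
      e ^+ 2 * kappa * \sum_(l <- ls) G l v.
    by rewrite ler_wpM2l// mulr_ge0// sqr_ge0.
  by move: q1 q2; lra.
(* A positive gap [g] would contradict the bound as soon as [k > C / g]. *)
suff step (k : nat) : (0 < k)%N ->
    gauss_ops ms F u <= gauss_ops ls F u + C / k%:R.
  rewrite leNgt; apply/negP; rewrite -subr_gt0 => gap.
  set g := _ - _ in gap.
  pose k := (Num.truncn (C / g)).+1.
  have k0 : 0 < k%:R :> R by rewrite ltr0n.
  have := step k isT; apply/negP; rewrite -ltNge -ltrBrDl -/g.
  by rewrite ltr_pdivrMr// mulrC -ltr_pdivrMr// truncnS_gt.
move=> k0; have kn0 : k%:R != 0 :> R by rewrite pnatr_eq0 -lt0n.
pose e : R := k%:R^-1; have e0 : 0 < e by rewrite invr_gt0 ltr0n.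
(* The deviation accumulated after [j] independent steps of deviation [e]. *)
pose sg (j : nat) : R := Num.sqrt j%:R * e.
have sg0 j : 0 <= sg j by rewrite mulr_ge0 ?sqrtr_ge0 ?ltW.
have sgS j : sg j ^+ 2 + e ^+ 2 = sg j.+1 ^+ 2.
  by rewrite !exprMn !sqr_sqrtr// -natr1 mulrDl mul1r.
pose K := (k ^ 2)%N.
have sgK : sg K = 1.
  by rewrite /sg /K natrX sqrtr_sqr ger0_norm// /e divff.
(* The hybrid in which [j] of the [K] steps already run along [ls]. *)
pose H j := scaled_ops (sg j) ls (scaled_ops (sg (K - j)%N) ms F).
have HS j : (j < K)%N -> forall v, H j v <= H j.+1 v + C * e ^+ 3.
  move=> jK v; rewrite /H -(subnSK jK).
  set q := (K - j.+1)%N.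
  have n1 : nice (scaled_ops e ms F) by exact: nice_gauss_ops.
  have n2 : nice (scaled_ops e ls F) by exact: nice_gauss_ops.
  rewrite -(scaled_ops_semigroup ms nF e0 (sg0 q) (sg0 q.+1) (sgS q)).
  rewrite -(scaled_ops_semigroup ls _ e0 (sg0 j) (sg0 j.+1) (sgS j));
    last exact: nice_gauss_ops.
  (* Commuting the exchanged step inwards presents both hybrids as the same monotone operator
     applied to one step on [F], where [hC] compares them. *)
  rewrite [scaled_ops e ls (scaled_ops (sg q) ms F)]gauss_opsC//.
  rewrite -/(scaled_ops e ls F) -/(scaled_ops (sg q) ms _).
  have -> : scaled_ops (sg j) ls (scaled_ops (sg q) ms (scaled_ops e ls F)) v
      + C * e ^+ 3 =
    scaled_ops (sg j) ls (scaled_ops (sg q) ms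
      (fun w => scaled_ops e ls F w + C * e ^+ 3)) v.
    rewrite /scaled_ops gauss_opsDcst// gauss_opsDcst//.
    exact: nice_gauss_ops.
  have n3 := niceD n2 (nice_cst (C * e ^+ 3)).
  apply: le_gauss_ops; [exact: nice_gauss_ops|exact: nice_gauss_ops|] => w.
  apply: le_gauss_ops => // x.
  by apply: hC; exact: ltW.
have Hj j : (j <= K)%N -> H 0%N u <= H j u + j%:R * (C * e ^+ 3).
  elim: j => [|j ih] jK; first by rewrite mul0r addr0.
  apply: (le_trans (ih (ltnW jK))).
  by rewrite -natr1 mulrDl mul1r addrA addrAC lerD2r HS.
have := Hj K (leqnn K).
have sg00 : sg 0%N = 0 by rewrite /sg sqrtr0 mul0r.
rewrite /H subn0 subnn sgK sg00 !scaled_ops0 !scaled_ops1.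
suff -> : K%:R * (C * e ^+ 3) = C / k%:R by [].
by rewrite /K natrX /e; field.
Qed.

End lindeberg.

(** * Taylor's formula of order two with Lipschitz second derivative *)

Section taylor.
Context {R : realType}.

Lemma MVT0 (f f1 : R -> R) (x : R) : (forall y : R, is_derive y (1 : R) f (f1
  y)) ->
  f 0 = 0 -> exists2 c, `|c| <= `|x| & f x = f1 c * x.
Proof.
move=> df f0.
have cf : continuous f.
  by move=> y; apply/differentiable_continuous/derivable1_diffP; exact:
    ex_derive.
have [x0|x0] := leP 0 x.
- have [|c] := @MVT_segment R f f1 0 x x0 (fun y _ => df y).
    exact: continuous_subspaceT.
  rewrite in_itv/= f0 !subr0 => /andP[c0 cx] ->; exists c => //.
  by rewrite !ger0_norm.
- have [|c] := @MVT_segment R f f1 x 0 (ltW x0) (fun y _ => df y).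
    exact: continuous_subspaceT.
  rewrite in_itv/= f0 !sub0r mulrN => /andP[xc c0] /oppr_inj ->; exists c => //.
  by rewrite !ler0_norm ?lerN2// ltW.
Qed.

(** The mean value theorem is applied first to the remainder [r1] of [f1], then to the remainder
    [r0] of [f], whose derivative is [r1]; each application gains one power of [|z|]. *)
Lemma taylor2 (f f1 f2 : R -> R) (L z : R) :
  (forall x : R, is_derive x (1 : R) f (f1 x)) ->
  (forall x : R, is_derive x (1 : R) f1 (f2 x)) ->
  0 <= L -> (forall x, `|f2 x - f2 0| <= L * `|x|) ->
  `|f z - (f 0 + z * f1 0 + z ^+ 2 / 2 * f2 0)| <= L * `|z| ^+ 3.
Proof.
move=> df df1 L0 f2L.
pose r1 x := f1 x - (f1 0 + x * f2 0).
have dr1 (x : R) : is_derive x (1 : R) r1 (f2 x - f2 0).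
  rewrite /r1; apply: is_derive_eq.
  by rewrite /GRing.scale /=; ring.
have r1L x : `|r1 x| <= L * `|x| ^+ 2.
  have [|c cx ->] := @MVT0 r1 _ x dr1.
    by rewrite /r1 mul0r addr0 subrr.
  rewrite normrM expr2 mulrA ler_wpM2r// (le_trans (f2L _))//.
  exact: ler_wpM2l.
pose r0 x := f x - (f 0 + x * f1 0 + x ^+ 2 / 2 * f2 0).
have dr0 (x : R) : is_derive x (1 : R) r0 (r1 x).
  rewrite /r0 /r1; apply: is_derive_eq.
  by rewrite /GRing.scale /=; field.
have [|c cz] := @MVT0 r0 _ z dr0.
  by rewrite /r0 expr0n/= !mul0r !addr0 subrr.
rewrite -/(r0 z) => ->; rewrite normrM exprSr mulrA ler_wpM2r//.
apply: (le_trans (r1L _)); rewrite ler_wpM2l// lerXn2r ?nnegrE//.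
Qed.

End taylor.

(** * The smooth test function and its derivatives *)

Section softmax.
Context {R : realType} {m : nat}.
Implicit Types (u v l : 'I_m -> R).

Definition softstep u : R := (1 + \sum_(s < m) expR (u s))^-1.

(** These weights express the gradient: the derivative of [softstep] in coordinate [s] is
    [- softstep u * softweight s u]. *)
Definition softweight s u : R := expR (u s) * softstep u.

Definition softstep_d1 l u : R := - softstep u * \sum_(s < m) l s * softweight
  s u.

Definition softstep_d2 l u : R := softstep u *
  (2 * (\sum_(s < m) l s * softweight s u) ^+ 2
   + - (\sum_(s < m) l s ^+ 2 * softweight s u)).

Let den_gt0 u : 0 < 1 + \sum_(s < m) expR (u s).
Proof. by rewrite ltr_pwDl// sumr_ge0// => s _; exact: expR_ge0. Qed.

Lemma softstep_gt0 u : 0 < softstep u.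
Proof. by rewrite invr_gt0. Qed.

Lemma softweight_ge0 s u : 0 <= softweight s u.
Proof. by rewrite mulr_ge0 ?expR_ge0// ltW// softstep_gt0. Qed.

Lemma softstep_le1 u : softstep u <= 1.
Proof.
by rewrite invf_le1// lerDl sumr_ge0// => s _; exact: expR_ge0.
Qed.

Lemma softweight_le1 s u : softweight s u <= 1.
Proof.
rewrite /softweight ler_pdivrMr// mul1r (bigD1 s)//= addrCA lerDl addr_ge0//.
by rewrite sumr_ge0// => t _; exact: expR_ge0.
Qed.

Let coord_le_dist1 s u v : u s <= dist1 u v + v s.
Proof.
rewrite -lerBlDr (le_trans (ler_norm _))// /dist1 (bigD1 s)//= lerDl.
exact: sumr_ge0.
Qed.

(** Passing from [u] to [v] multiplies each term of the denominator by at most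
    [expR (dist1 u v)]. *)
Lemma softstep_expR u v : expR (- dist1 u v) * softstep u <= softstep v.
Proof.
rewrite expRN /softstep -invfM lef_pV2 ?posrE ?mulr_gt0 ?expR_gt0//.
rewrite mulrDr mulr1 mulr_sumr; apply: lerD.
  by rewrite -expR0 ler_expR dist1_ge0.
apply: ler_sum => s _; rewrite -expRD ler_expR.
rewrite (_ : dist1 u v = dist1 v u); first exact: coord_le_dist1.
by apply: eq_bigr => t _; rewrite distrC.
Qed.

(** The factor 2 arises because the numerator and [softstep] each lose [expR (dist1 u v)]. *)
Lemma softweight_expR s u v :
  expR (- (2 * dist1 u v)) * softweight s u <= softweight s v.
Proof.
have -> : expR (- (2 * dist1 u v)) * softweight s u =
    (expR (- dist1 u v) * expR (u s)) * (expR (- dist1 u v) * softstep u).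
  rewrite /softweight (_ : - (2 * dist1 u v) = - dist1 u v + - dist1 u v).
    by rewrite expRD; ring.
  by ring.
rewrite /softweight ler_pM ?mulr_ge0 ?expR_ge0 ?softstep_expR//.
  by rewrite ltW// softstep_gt0.
by rewrite -expRD ler_expR addrC lerBlDl coord_le_dist1.
Qed.

(** For values in the unit interval, [expR (- t) >= 1 - t] turns a multiplicative bound into an
    additive one; exchanging [u] and [v] gives the absolute value. *)
Let lipschitz_expR (f : ('I_m -> R) -> R) (k : R) : 0 <= k ->
  (forall u, 0 <= f u <= 1) ->
  (forall u v, expR (- (k * dist1 u v)) * f u <= f v) ->
  forall u v, `|f u - f v| <= k * dist1 u v.
Proof.
move=> k0 f01 fe.
have h u v : f u - f v <= k * dist1 u v.
  have D0 : 0 <= k * dist1 u v by rewrite mulr_ge0// dist1_ge0.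
  have /andP[f0 f1] := f01 u.
  have h1 := expR_ge1Dx (- (k * dist1 u v)).
  have := ler_wpM2r f0 h1; have := fe u v.
  have : k * dist1 u v * f u <= k * dist1 u v by rewrite ler_piMr.
  by rewrite mulrDl mul1r mulNr; lra.
move=> u v; rewrite ler_norml h andbT lerNl opprB.
rewrite (_ : dist1 u v = dist1 v u) ?h//.
by apply: eq_bigr => t _; rewrite distrC.
Qed.

Lemma nice_softstep : nice softstep.
Proof.
have F01 u : 0 <= softstep u <= 1 by rewrite ltW ?softstep_gt0// softstep_le1.
split.
- by exists 1 => u; have /andP[? ?] := F01 u; rewrite ger0_norm.
- exists 1 => // u v; apply: lipschitz_expR => // w w'.
  by rewrite mul1r softstep_expR.
- move=> d V c mc.
  (* The inverse of a positive number is written with [expR] and [ln], both measurable. *)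
  rewrite (_ : (fun _ => _) =
      fun x => expR (- ln (1 + \sum_(s < m) expR (c s x)))).
    apply: (measurableT_comp (@measurable_expR R)); apply: measurable_funN.
    apply: (measurableT_comp (@measurable_ln R)); apply: measurable_funD => //.
    by apply: measurable_sum => s; exact: (measurableT_comp (@measurable_expR
      R)).
  by apply/funext => x; rewrite expRN lnK// posrE.
Qed.

Lemma nice_softweight s : nice (softweight s).
Proof.
have w01 u : 0 <= softweight s u <= 1.
  by rewrite softweight_ge0 softweight_le1.
split.
- by exists 1 => u; have /andP[? ?] := w01 u; rewrite ger0_norm.
- by exists 2 => // u v; apply: lipschitz_expR => // w w'; exact:
    softweight_expR.
- move=> d V c mc; apply: measurable_funM.
    exact: (measurableT_comp (@measurable_expR R)).
  exact: (nice_measurable nice_softstep).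
Qed.

Lemma nice_softstep_d2 l : nice (softstep_d2 l).
Proof.
apply: niceM; first exact: nice_softstep.
apply: niceD.
  apply: niceZ; apply: niceM; apply: nice_sum => s; apply: niceZ;
    exact: nice_softweight.
rewrite (_ : (fun _ => _) =
    fun u => -1 * \sum_(s < m) l s ^+ 2 * softweight s u).
  by apply: niceZ; apply: nice_sum => s; apply: niceZ; exact: nice_softweight.
by apply/funext => u; rewrite mulN1r.
Qed.

(** The power [k] lets one rule serve twice: [k = 0] differentiates the denominator, [k = 1] its
    derivative. *)
Let is_derive_exp (k : nat) u l (z : R) : is_derive z (1 : R)
  (fun z => \sum_(s < m) l s ^+ k * expR (shift u z l s))
  (\sum_(s < m) l s ^+ k.+1 * expR (shift u z l s)).
Proof.
rewrite (_ : (fun _ => _) =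
  \sum_(s < m) (fun z => l s ^+ k * expR (shift u z l s))); last first.
  by apply/funext => x; rewrite fct_sumE.
apply: is_derive_sum => s; rewrite /shift.
apply: is_derive_eq.
by rewrite exprS /GRing.scale /=; ring.
Qed.

Let sum_softweight (k : nat) l u : \sum_(s < m) l s ^+ k * softweight s u =
  softstep u * \sum_(s < m) l s ^+ k * expR (u s).
Proof.
by rewrite mulr_sumr; apply: eq_bigr => s _; rewrite /softweight; ring.
Qed.

Let sum_softweight1 l u : \sum_(s < m) l s * softweight s u =
  softstep u * \sum_(s < m) l s ^+ 1 * expR (u s).
Proof.
rewrite -(sum_softweight 1); apply: eq_bigr => s _; by rewrite expr1.
Qed.

Lemma is_derive_softstep u l (z : R) : is_derive z (1 : R)
  (fun z => softstep (shift u z l)) (softstep_d1 l (shift u z l)).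
Proof.
have h := is_derive_exp 0 u l z.
have d : is_derive z (1 : R)
    (fun z => 1 + \sum_(s < m) l s ^+ 0 * expR (shift u z l s))
    (\sum_(s < m) l s ^+ 1 * expR (shift u z l s)).
  by apply: is_derive_eq; rewrite add0r mul1r.
have dE (y : R) : 1 + \sum_(s < m) l s ^+ 0 * expR (shift u y l s) =
    1 + \sum_(s < m) expR (shift u y l s).
  by congr (_ + _); apply: eq_bigr => s _; rewrite expr0 mul1r.
rewrite (_ : (fun z => _) =
    fun z => (1 + \sum_(s < m) l s ^+ 0 * expR (shift u z l s))^-1); last first.
  by apply/funext => y; rewrite dE.
apply: is_derive_eq; first by apply: is_deriveV d; rewrite dE gt_eqF.
rewrite /softstep_d1 sum_softweight1 dE /softstep /GRing.scale /=.
by rewrite expr2 invfM; ring.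
Qed.

Lemma is_derive_softstep_d1 u l (z : R) : is_derive z (1 : R)
  (fun z => softstep_d1 l (shift u z l)) (softstep_d2 l (shift u z l)).
Proof.
have h1 := is_derive_exp 1 u l z.
have h := is_derive_softstep u l z.
rewrite (_ : (fun z => _) = fun z => - (softstep (shift u z l) *
    (softstep (shift u z l) *
     \sum_(s < m) l s ^+ 1 * expR (shift u z l s)))); last first.
  by apply/funext => y; rewrite /softstep_d1 sum_softweight1; ring.
apply: is_derive_eq.
rewrite /softstep_d2 /softstep_d1 sum_softweight1 (sum_softweight 2).
by rewrite /GRing.scale /=; ring.
Qed.

Lemma softstep_taylor l : exists2 C : R, 0 <= C & forall u z,
  `|softstep (shift u z l) -
    (softstep u + z * softstep_d1 l u + z ^+ 2 / 2 * softstep_d2 l u)|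
  <= C * `|z| ^+ 3.
Proof.
have [L L0 GL] := nice_lipschitz (nice_softstep_d2 l).
exists (L * \sum_(s < m) `|l s|) => [|u z]; first by rewrite mulr_ge0//
  sumr_ge0.
have s0 : shift u 0 l = u by apply/funext => s; rewrite /shift mul0r addr0.
have := taylor2 z (is_derive_softstep u l) (is_derive_softstep_d1 u l).
rewrite s0; apply; first by rewrite mulr_ge0// sumr_ge0.
move=> x; rewrite (le_trans (GL _ _))// dist1_shiftl.
by rewrite le_eqVlt; apply/orP; left; apply/eqP; ring.
Qed.

(** Summed over the directions, the second derivative depends on them through their Gram matrix
    alone: the full matrix enters with nonnegative coefficients, and the negative term sees the
    diagonal. *)
Lemma sum_softstep_d2 (I : Type) (r : seq I) (l : I -> 'I_m -> R) u :
  \sum_(k <- r) softstep_d2 (l k) u = softstep u *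
    (2 * (\sum_(s < m) \sum_(t < m)
       (\sum_(k <- r) l k s * l k t) * (softweight s u * softweight t u))
     - \sum_(s < m) (\sum_(k <- r) l k s * l k s) * softweight s u).
Proof.
rewrite /softstep_d2 -mulr_sumr; congr (_ * _).
rewrite big_split/= sumrN -mulr_sumr; congr (_ * _ - _).
- rewrite (eq_bigr (fun k => \sum_(s < m) \sum_(t < m)
      (l k s * softweight s u) * (l k t * softweight t u))); last first.
    by move=> k _; rewrite expr2 big_distrlr.
  rewrite exchange_big/=; apply: eq_bigr => s _.
  rewrite exchange_big/=; apply: eq_bigr => t _.
  by rewrite mulr_suml; apply: eq_bigr => k _; ring.
- rewrite exchange_big/=; apply: eq_bigr => s _.
  by rewrite mulr_suml; apply: eq_bigr => k _; rewrite expr2.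
Qed.

(** Equal diagonals fix the negative part of [sum_softstep_d2], and larger covariances increase the
    other part; [gauss_ops_compare] integrates this inequality. *)
Lemma slepian_softstep (I J : Type) (r : seq I) (q : seq J)
    (x : I -> 'I_m -> R) (y : J -> 'I_m -> R) :
  (forall s, \sum_(k <- r) x k s * x k s = \sum_(k <- q) y k s * y k s) ->
  (forall s t, \sum_(k <- q) y k s * y k t <= \sum_(k <- r) x k s * x k t) ->
  forall u, gauss_ops (map y q) softstep u <= gauss_ops (map x r) softstep u.
Proof.
move=> xy_diag xy_off; apply: (gauss_ops_compare nice_softstep nice_softstep_d2
  softstep_taylor) => u.
rewrite !big_map !sum_softstep_d2 ler_wpM2l ?(ltW (softstep_gt0 u))// lerB//.
  rewrite ler_wpM2l//; apply: ler_sum => s _; apply: ler_sum => t _.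
  by rewrite ler_wpM2r// mulr_ge0// softweight_ge0.
by rewrite le_eqVlt; apply/orP; left; apply/eqP;
  apply: eq_bigr => s _; rewrite xy_diag.
Qed.

End softmax.

(** * From independent normal variables to iterated Gaussian operators *)

Section transfer.
Context d (T : measurableType d) {R : realType} (P : probability T R).
Context {K : eqType}.
Variable xi : K -> T -> R.
Hypothesis mxi : forall k, measurable_fun setT (xi k).
Local Notation gauss := (@normal_prob R 0 1).
Local Notation image_measure :=
  measure_function_pushforward__canonical__measure_function_Measure.

(** For duplicate-free [ks] and [D = setT], the listed variables are independent standard normals; a
    general [D] is moreover an event independent of them. *)
Definition gauss_indep (D : set T) (ks : seq K) : Prop :=
  forall B : K -> set R, (forall k, measurable (B k)) ->
  P (D `&` \big[setI/setT]_(k <- ks) (xi k @^-1` B k)) =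
  (P D * \prod_(k <- ks) gauss (B k))%E.

Let mxi_pre k (B : set R) : measurable B -> measurable (xi k @^-1` B).
Proof. by move=> mB; rewrite -[X in measurable X]setTI; exact: mxi. Qed.

Lemma gauss_indep_head D k ks (B : set R) : k \notin ks -> measurable B ->
  gauss_indep D (k :: ks) -> P (D `&` (xi k @^-1` B)) = (P D * gauss B)%E.
Proof.
move=> kks mB iD; have := iD (fun j => if j == k then B else setT).
rewrite !big_cons eqxx big_seq big1; last first.
  move=> j jks; case: eqP => [jk|_]; last by rewrite preimage_setT.
  by move: kks; rewrite -jk jks.
rewrite setIT [X in (_ * (_ * X))%E]big_seq big1; last first.
  move=> j jks; case: eqP => [jk|_]; last exact: probability_setT.
  by move: kks; rewrite -jk jks.
by rewrite mule1; apply => j; case: ifP.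
Qed.

Lemma gauss_indep_tail D k ks (B : set R) : k \notin ks -> measurable B ->
  gauss_indep D (k :: ks) -> gauss_indep (D `&` (xi k @^-1` B)) ks.
Proof.
move=> kks mB iD C mC; rewrite (gauss_indep_head kks mB iD).
have := iD (fun j => if j == k then B else C j).
rewrite !big_cons eqxx setIA.
rewrite [in X in P (_ `&` X)]big_seq [in X in P (_ `&` X)](eq_bigr (fun j => xi
  j @^-1` C j));
  last first.
  by move=> j jks; case: eqP => // jk; move: kks; rewrite -jk jks.
rewrite -big_seq [X in (_ * (_ * X))%E]big_seq.
rewrite [X in (_ * (_ * X))%E](eq_bigr (fun j => gauss (C j))); last first.
  by move=> j jks; case: eqP => // jk; move: kks; rewrite -jk jks.
by rewrite -big_seq muleA; apply => j; case: ifP.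
Qed.

(* Carrying an arbitrary event [D] independent of the family makes the induction
   on [ks] go through: [D] absorbs the constraint on the variable removed. *)
Lemma gauss_indep_model ks : uniq ks ->
  exists (d' : measure_display) (V : measurableType d') (mu : probability V R)
    (X : T -> V) (c : K -> V -> R),
  [/\ measurable_fun setT X, (forall k, measurable_fun setT (c k)),
    (forall k, k \in ks -> xi k = c k \o X),
    (forall D, measurable D -> gauss_indep D ks -> forall C, measurable C ->
       P (D `&` (X @^-1` C)) = (P D * mu C)%E) &
    forall m (f : ('I_m -> R) -> R), nice f -> forall u (l : K -> 'I_m -> R),
      \int[mu]_v f (fun s => u s + \sum_(k <- ks) c k v * l k s) =
      gauss_ops [seq l k | k <- ks] f u].
Proof.
elim: ks => [_|k0 ks ih /= /andP[k0ks uks]].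
  exists _, unit, (dirac tt), (fun=> tt), (fun _ _ => 0); split=> //.
  - move=> D mD _ C mC; rewrite /= /dirac indicE.
    case: (boolP (tt \in C)) => ttC.
      rewrite mule1; congr (P _); apply/seteqP; split=> [x []//|x Dx].
      by split=> //; exact: set_mem ttC.
    rewrite mule0 (_ : _ `&` _ = set0) ?measure0//.
    by rewrite -subset0 => x [_ /= Ctt]; move/negP: ttC; apply; exact: mem_set.
  - move=> m f nf u l /=.
    rewrite (_ : (fun v => _) = fun=> f u); first exact: Rintegral_prob_cst.
    apply/funext => v; congr f; apply/funext => s.
    by rewrite big_nil addr0.
have [d' [V [mu [X [c [mX mc cX lawX intX]]]]]] := ih uks.
pose V' : measurableType _ := (measurableTypeR R * V)%type.
pose X' w : V' := (xi k0 w, X w).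
pose c' k (v : V') : R := if k == k0 then v.1 else c k v.2.
have mX' : measurable_fun setT X' := measurable_fun_pair (mxi k0) mX.
have mc' k : measurable_fun setT (c' k).
  rewrite /c'; case: eqP => _; first exact: measurable_fst.
  exact: (measurableT_comp (mc k)).
exists _, V', (gauss \x mu)%E, X', c'; split => //.
- move=> k; rewrite inE /c'; case: eqP => [->|_]//= kks.
  by rewrite {1}(cX k kks).
- move=> D mD iD C mC.
  (* A null event is treated apart, since the next argument conditions on [D]. *)
  have [PD0|PD0] := eqVneq (P D) 0%E.
    rewrite PD0 mul0e; apply/eqP; rewrite -measure_le0 -PD0 le_measure ?inE//.
    by apply: measurableI => //; rewrite -[X in measurable X]setTI; exact: mX'.
  have PDfin : P D \is a fin_num by exact: fin_num_measure.
  pose a := fine (P D); have PDE : P D = a%:E by rewrite fineK.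
  have a0 : 0 < a by rewrite fine_gt0// lt0e PD0 measure_ge0 ltey_eq PDfin.
  have r0 : 0 <= a^-1 by rewrite invr_ge0 ltW.
  (* The conditional law of [X'] given [D]. It has the right values on rectangles, so uniqueness of
     the product measure identifies it. *)
  pose nu := mscale (NngNum r0) (image_measure (mrestr P mD) mX').
  have nuE E : measurable E -> nu E = (a^-1%:E * P (D `&` X' @^-1` E))%E.
    by move=> mE; rewrite /nu /mscale/= /pushforward /mrestr setIC.
  transitivity (P D * nu C)%E.
    by rewrite nuE// muleA PDE -EFinM divff ?mul1e// gt_eqF.
  congr (_ * _)%E; apply/esym.
  apply: (@product_measure_unique _ _ _ _ _ gauss mu nu) => // B E mB mE.
  rewrite -[LHS]/(nu (B `*` E)) nuE; last exact: measurableX.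
  rewrite (_ : X' @^-1` _ = xi k0 @^-1` B `&` X @^-1` E)// setIA.
  rewrite (lawX _ _ (gauss_indep_tail k0ks mB iD))//; last first.
    by apply: measurableI => //; exact: mxi_pre.
  rewrite (gauss_indep_head k0ks mB iD) PDE !muleA -EFinM.
  by rewrite mulVf ?mul1e// gt_eqF.
- move=> m f nf u l; have [C fC] := nice_bounded nf.
  rewrite -(@Rintegral12 _ _ _ _ _ gauss mu _ C)//; last first.
    apply: (nice_measurable nf (V := V')
      (c := fun s v => u s + \sum_(k <- k0 :: ks) c' k v * l k s)) => s.
    apply: measurable_funD => //; apply: measurable_sum => k.
    exact: measurable_funM.
  apply: eq_Rintegral => z _; rewrite -/(gauss_ops _ f) -(intX _ f nf).
  apply: eq_Rintegral => v _; congr f; apply/funext => s.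
  rewrite big_cons /shift addrA {1}/c' eqxx; congr (_ + _).
  rewrite big_seq [RHS]big_seq; apply: eq_bigr => k kks; rewrite /c'.
  by case: eqP => // kk0; move: k0ks; rewrite -kk0 kks.
Qed.

End transfer.

Section gauss_transfer.
Context d (T : measurableType d) {R : realType} (P : probability T R).
Context {K : eqType}.
Variable xi : K -> T -> R.
Hypothesis mxi : forall k, measurable_fun setT (xi k).
Local Notation image_measure :=
  measure_function_pushforward__canonical__measure_function_Measure.

(** With [D = setT], the model measure is the law of [X], so the expectation is an integral over the
    model, already known to be the iterated operator. *)
Lemma gauss_transfer (ks : seq K) m (f : ('I_m -> R) -> R) u
    (l : K -> 'I_m -> R) : uniq ks -> gauss_indep P xi setT ks -> nice f ->
  \int[P]_w f (fun s => u s + \sum_(k <- ks) xi k w * l k s) =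
  gauss_ops [seq l k | k <- ks] f u.
Proof.
move=> uks iks nf; have [C fC] := nice_bounded nf.
have [d' [V [mu [X [c [mX mc cX lawX intX]]]]]] :=
  gauss_indep_model P mxi uks.
rewrite -(intX _ _ nf) /Rintegral; congr fine.
pose g v := f (fun s => u s + \sum_(k <- ks) c k v * l k s).
have mg : measurable_fun setT g.
  apply: (nice_measurable nf) => s; apply: measurable_funD => //.
  by apply: measurable_sum => k; exact: measurable_funM.
rewrite [RHS](eq_measure_integral (image_measure P mX)); last first.
  move=> A mA _; have := lawX setT measurableT iks A mA.
  by rewrite setTI probability_setT mul1e => e; exact: esym e.
rewrite (integral_pushforward mX (f := EFin \o g))//=.
- rewrite preimage_setT; apply: eq_integral => w _; congr (f _)%:E.
  apply/funext => s; congr (_ + _); rewrite big_seq [RHS]big_seq.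
  by apply: eq_bigr => k kks; rewrite (cX k kks).
- exact/measurable_EFinP.
- rewrite preimage_setT; apply: (bounded_integrable P (C := C) (f := g \o X)).
    exact: measurableT_comp.
  by move=> w; exact: fC.
Qed.

End gauss_transfer.

(** * Finite maxima, and how closely the test function follows them *)

Section running_max.
Context {R : realType}.
Implicit Types f : nat -> R.

Fixpoint running_max f n : R :=
  if n is n'.+1 then Num.max (running_max f n') (f n) else f 0%N.

Lemma le_running_max f n i : (i <= n)%N -> f i <= running_max f n.
Proof.
elim: n => [|n ih]; first by rewrite leqn0 => /eqP ->.
rewrite leq_eqVlt => /orP[/eqP ->|]; first by rewrite /= le_max lexx orbT.
by rewrite ltnS /= le_max => /ih ->.
Qed.

Lemma running_max_le f n b : (forall i, (i <= n)%N -> f i <= b) ->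
  running_max f n <= b.
Proof.
elim: n => [|n ih] fb /=; first exact: fb.
by rewrite ge_max fb// andbT ih// => i ni; apply: fb; exact: leqW.
Qed.

Lemma running_max_mono f n p : (n <= p)%N -> running_max f n <= running_max f p.
Proof.
by move=> np; apply: running_max_le => i ni; apply: le_running_max;
  exact: leq_trans np.
Qed.

Lemma running_max_attained f n : exists2 i, (i <= n)%N & running_max f n = f i.
Proof.
elim: n => [|n [i ni e]] /=; first by exists 0%N.
rewrite maxEle; case: ifP => _; first by exists n.+1.
by exists i => //; exact: leqW.
Qed.

Lemma measurable_running_max d (T : measurableType d) (f : nat -> T -> R) n :
  (forall i, measurable_fun setT (f i)) ->
  measurable_fun setT (fun w => running_max (f ^~ w) n).
Proof.
move=> mf; elim: n => [|n ih] /=; first exact: mf.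
exact: measurable_maxr.
Qed.

End running_max.

Section softstep_bounds.
Context {R : realType} {m : nat}.
Variables (u : 'I_m -> R) (de : R).
Hypothesis de0 : 0 < de.

(** A single term of the denominator already reaches [de^-1]. *)
Lemma softstep_le s : - ln de <= u s -> softstep u <= de.
Proof.
move=> h; rewrite /softstep -[leRHS]invrK lef_pV2 ?posrE ?invr_gt0//; last
  first.
  by rewrite ltr_pwDl// sumr_ge0// => i _; exact: expR_ge0.
rewrite -[de]lnK ?posrE// -expRN (bigD1 s)//= addrCA.
rewrite -[leLHS]addr0 lerD ?ler_expR//.
by rewrite addr_ge0// sumr_ge0// => i _; exact: expR_ge0.
Qed.

(** The exponentials sum to some [x <= m%:R * de], and [1 / (1 + x) >= 1 - x]. *)
Lemma softstep_ge : (forall s, u s <= ln de) -> 1 - m%:R * de <= softstep u.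
Proof.
move=> h; have S : \sum_(s < m) expR (u s) <= m%:R * de.
  rewrite -[m in leRHS]card_ord mulr_natl -sumr_const; apply: ler_sum => s _.
  by rewrite -[leRHS]lnK ?posrE// ler_expR.
have S0 : 0 <= \sum_(s < m) expR (u s).
  by apply: sumr_ge0 => s _; exact: expR_ge0.
rewrite /softstep; set x := \sum_(s < m) _ in S S0 *.
have x1 : 0 < 1 + x by rewrite ltr_pwDl.
apply: (@le_trans _ _ (1 - x)); first by rewrite lerB.
rewrite -[leRHS]mul1r ler_pdivlMr// mulrDr mulrBl mul1r mulr1.
by have := sqr_ge0 x; rewrite expr2; lra.
Qed.

End softstep_bounds.

(** * Linear Gaussian processes and Slepian's inequality for finite maxima *)

Section linear_process.
Context d (T : measurableType d) {R : realType} {K : finType} {U : Type}.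
Variables (xi : K -> T -> R) (x : K -> U -> R).

Definition process (a : U) (w : T) : R := \sum_k xi k w * x k a.

Lemma measurable_process a : (forall k, measurable_fun setT (xi k)) ->
  measurable_fun setT (process a).
Proof.
by move=> mxi; apply: measurable_sum => k; exact: measurable_funM.
Qed.

(** The covariance of [process] at [a] and [b] when the [xi] are independent standard normals. *)
Definition covariance_of a b : R := \sum_k x k a * x k b.

End linear_process.

Section slepian.
Context d1 d2 (T1 : measurableType d1) (T2 : measurableType d2) {R : realType}.
Variables (P1 : probability T1 R) (P2 : probability T2 R).
Context {K1 K2 : finType} {U : Type}.
Variables (xi1 : K1 -> T1 -> R) (xi2 : K2 -> T2 -> R).
Variables (x1 : K1 -> U -> R) (x2 : K2 -> U -> R).
Hypothesis mxi1 : forall k, measurable_fun setT (xi1 k).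
Hypothesis mxi2 : forall k, measurable_fun setT (xi2 k).
Hypothesis ixi1 : gauss_indep P1 xi1 setT (enum K1).
Hypothesis ixi2 : gauss_indep P2 xi2 setT (enum K2).
Variable y : nat -> U.
Hypothesis var_eq : forall i,
  covariance_of x1 (y i) (y i) = covariance_of x2 (y i) (y i).
Hypothesis cov_le : forall i j,
  covariance_of x2 (y i) (y j) <= covariance_of x1 (y i) (y j).

Local Notation X1 := (process xi1 x1).
Local Notation X2 := (process xi2 x2).

Let max1 n w := running_max (fun i => X1 (y i) w) n.
Let max2 n w := running_max (fun i => X2 (y i) w) n.

Let mmax1 n : measurable_fun setT (max1 n).
Proof. by apply: measurable_running_max => i; exact: measurable_process. Qed.

Let mmax2 n : measurable_fun setT (max2 n).
Proof. by apply: measurable_running_max => i; exact: measurable_process. Qed.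

(** The rescaling by [b] multiplies all covariances by [b ^+ 2], which preserves both hypotheses,
    and the level [r] becomes the base point of the operators. *)
Let le_softstep (n : nat) (b r : R) :
  \int[P2]_w softstep (fun s : 'I_n.+1 => b * (X2 (y s) w - r)) <=
  \int[P1]_w softstep (fun s : 'I_n.+1 => b * (X1 (y s) w - r)).
Proof.
have E d (T : measurableType d) (P : probability T R) (K : finType)
    (xi : K -> T -> R) (x : K -> U -> R) :
    (forall k, measurable_fun setT (xi k)) -> gauss_indep P xi setT (enum K) ->
    \int[P]_w softstep (fun s : 'I_n.+1 => b * (process xi x (y s) w - r)) =
    gauss_ops [seq (fun s : 'I_n.+1 => b * x k (y s)) | k <- enum K] softstep
      (fun=> - (b * r)).
  move=> mxi ixi.
  rewrite -(gauss_transfer mxi _ (fun k (s : 'I_n.+1) => b * x k (y s))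
    (enum_uniq K) ixi (nice_softstep (m := n.+1))).
  apply: eq_Rintegral => w _; congr softstep; apply/funext => s.
  rewrite mulrBr addrC /process big_enum/= mulr_sumr; congr (_ + _).
  by apply: eq_bigr => k _; ring.
rewrite !E//; apply: slepian_softstep => [s|s t].
  have := var_eq s; rewrite /covariance_of => /(congr1 ( *%R (b ^+ 2))).
  by rewrite !big_enum/= !mulr_sumr => e; apply: etrans (etrans e _);
    apply: eq_bigr => k _; ring.
have := cov_le s t; rewrite /covariance_of => /(ler_wpM2l (sqr_ge0 b)).
rewrite !big_enum/= !mulr_sumr => e; apply: le_trans (le_trans e _);
  rewrite le_eqVlt; apply/orP; left; apply/eqP; apply: eq_bigr => k _; ring.
Qed.

(** The gap between [s] and [t] leaves room for [softstep] to fall from nearly 1 to nearly 0, so its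
    expectations control both tails up to a multiple of [de], which is arbitrary. *)
Lemma slepian_tail n (s t : R) : s < t ->
  (P1 [set w | (t <= max1 n w)%R] <= P2 [set w | (s < max2 n w)%R])%E.
Proof.
move=> st.
set A1 := [set w | t <= max1 n w]; set A2 := [set w | s < max2 n w].
have mA1 : measurable A1.
  have -> : A1 = max1 n @^-1` `[t, +oo[%classic.
    by apply/seteqP; split => w /=; rewrite in_itv/= andbT.
  by rewrite -[X in measurable X]setTI; exact: mmax1.
have mA2 : measurable A2.
  have -> : A2 = max2 n @^-1` `]s, +oo[%classic.
    by apply/seteqP; split => w /=; rewrite in_itv/= andbT.
  by rewrite -[X in measurable X]setTI; exact: mmax2.
suff H (de : R) : 0 < de -> de < 1 ->
    fine (P1 A1) <= fine (P2 A2) + (n.+2)%:R * de.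
  rewrite -[P1 A1]fineK ?fin_num_measure// -[P2 A2]fineK ?fin_num_measure//.
  rewrite lee_fin leNgt; apply/negP; rewrite -subr_gt0 => gap.
  set g := _ - _ in gap.
  (* The first bound keeps [de < 1], the second makes the total error at most [g / 2]. *)
  pose de := Num.min (2^-1) (g / (2 * n.+2%:R)).
  have n0 : 0 < n.+2%:R :> R by rewrite ltr0n.
  have de0 : 0 < de.
    by rewrite lt_min invr_gt0 ltr0n/= divr_gt0// mulr_gt0// ltr0n.
  have de1 : de < 1.
    by rewrite gt_min invf_lt1 ?ltr0n// ltr1n.
  have := H de de0 de1; apply/negP; rewrite -ltNge -ltrBrDl -/g.
  apply: (@le_lt_trans _ _ (n.+2%:R * (g / (2 * n.+2%:R)))).
    by rewrite ler_pM2l// ge_min lexx orbT.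
  by rewrite (_ : _ * _ = g / 2); [lra|field; rewrite gt_eqF].
move=> de0 de1.
have lnde : ln de < 0 by rewrite ln_lt0// de0.
(* Smoothing at the midpoint; [b] is such that [expR (- b (t - s) / 2) = de]. *)
pose r := (s + t) / 2.
pose b := - ln de / ((t - s) / 2).
have ts0 : 0 < (t - s) / 2 by rewrite divr_gt0// subr_gt0.
have b0 : 0 < b by rewrite divr_gt0// oppr_gt0.
have := le_softstep n b r.
pose f1 w := softstep (fun i : 'I_n.+1 => b * (X1 (y i) w - r)).
pose f2 w := softstep (fun i : 'I_n.+1 => b * (X2 (y i) w - r)).
have if1 : P1.-integrable setT (EFin \o f1).
  apply: (bounded_integrable P1 (C := 1)).
    apply: (nice_measurable (nice_softstep (m := n.+1))) => i.
    by apply: measurable_funM => //; apply: measurable_funB => //;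
      exact: measurable_process.
  by move=> w; rewrite ger0_norm ?softstep_le1// ltW// softstep_gt0.
have if2 : P2.-integrable setT (EFin \o f2).
  apply: (bounded_integrable P2 (C := 1)).
    apply: (nice_measurable (nice_softstep (m := n.+1))) => i.
    by apply: measurable_funM => //; apply: measurable_funB => //;
      exact: measurable_process.
  by move=> w; rewrite ger0_norm ?softstep_le1// ltW// softstep_gt0.
(* On [A1] the maximising coordinate satisfies [b * (t - r) = - ln de] or more, so the test function
   is at most [de]. *)
have h1 w : f1 w <= 1 + de - \1_A1 w.
  rewrite indicE; have [|_] := boolP (w \in A1); last first.
    by rewrite subr0 (le_trans (softstep_le1 _))// lerDl ltW.
  rewrite inE /A1 /= /max1 => tm.
  have [i ni e] := running_max_attained (fun i => X1 (y i) w) n.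
  rewrite addrAC subrr add0r.
  apply: (@softstep_le _ _ _ _ de0 (inord i)); rewrite inordK//.
  rewrite /b mulrAC ler_pdivlMr// ler_pM2l ?oppr_gt0// -e /r.
  by move: tm; lra.
(* Off [A2] all [n.+1] coordinates are at most [b * (s - r) = ln de]. *)
have h2 w : 1 - n.+1%:R * de - \1_A2 w <= f2 w.
  rewrite indicE; have [|] := boolP (w \in A2) => hw.
    apply: (@le_trans _ _ 0); last by rewrite ltW// softstep_gt0.
    rewrite lerBlDr add0r lerBlDr lerDl mulr_ge0// ltW//.
  have {}hw : max2 n w <= s.
    by rewrite leNgt; apply: contra hw => h; rewrite inE.
  rewrite subr0; apply: softstep_ge => // i.
  rewrite /b mulrAC ler_pdivrMr// mulNr -mulrN -[leRHS]mulrC -[leLHS]mulrC.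
  rewrite mulrC [leRHS]mulrC ler_nM2l// /r.
  have := @le_running_max _ (fun i => X2 (y i) w) n i (ltn_ord i).
  by move: hw; rewrite /max2; lra.
have indI d (T : measurableType d) (P : probability T R) (A : set T) (c : R) :
    measurable A -> P.-integrable setT (EFin \o (fun w => c - \1_A w)) /\
    \int[P]_w (c - \1_A w) = c - fine (P A).
  move=> mA.
  have ic : P.-integrable setT (EFin \o (fun _ : T => c)).
    exact: finite_measure_integrable_cst.
  have iA : P.-integrable setT (EFin \o (\1_A : T -> R)).
    apply: (bounded_integrable P (C := 1)); first exact: measurable_indic.
    by move=> w; rewrite indicE; case: (_ \in _); rewrite ?normr1 ?normr0.
  split; first exact: (integrableB measurableT ic iA).
  rewrite RintegralB// Rintegral_prob_cst /Rintegral; congr (_ - fine _).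
  by rewrite integral_indic// setIT.
have [i1 e1] := indI _ _ P1 A1 (1 + de) mA1.
have [i2 e2] := indI _ _ P2 A2 (1 - n.+1%:R * de) mA2.
have q1 : \int[P1]_w f1 w <= 1 + de - fine (P1 A1).
  by rewrite -e1; apply: le_Rintegral.
have q2 : 1 - n.+1%:R * de - fine (P2 A2) <= \int[P2]_w f2 w.
  by rewrite -e2; apply: le_Rintegral.
rewrite -/(f1 _) -/(f2 _) => q3.
(* The errors [de] and [n.+1%:R * de] add up to [n.+2%:R * de]. *)
have := le_trans q2 (le_trans q3 q1).
rewrite -[in X in _ -> X]natr1 mulrDl mul1r.
set a := fine _; set c := fine _; set e := _ * de.
by lra.
Qed.

End slepian.

(** * From tails to exponential moments *)

Section exponential_tail.
Context d1 d2 (T1 : measurableType d1) (T2 : measurableType d2) {R : realType}.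
Variables (P1 : probability T1 R) (P2 : probability T2 R).

(** Both moments are integrals of tail probabilities. The slack [e] supplies the strict gap that the
    tail comparison requires. *)
Lemma le_integral_expR_tail (X : T1 -> R) (Y : T2 -> R) (c e : R) :
  measurable_fun setT X -> measurable_fun setT Y -> 0 < c -> 0 < e ->
  (forall s t, s < t ->
    (P1 [set w | (t <= X w)%R] <= P2 [set w | (s < Y w)%R])%E) ->
  (\int[P1]_w (expR (c * X w))%:E <= \int[P2]_w (expR (c * (Y w + e)))%:E)%E.
Proof.
move=> mX mY c0 e0 XY.
have mf : measurable_fun setT (fun w => expR (c * X w)).
  by apply: (measurableT_comp (@measurable_expR R)); exact: measurable_funM.
have mg : measurable_fun setT (fun w => expR (c * (Y w + e))).
  apply: (measurableT_comp (@measurable_expR R)); apply: measurable_funM => //.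
  exact: measurable_funD.
pose f : {RV P1 >-> R} := HB.pack (fun w => expR (c * X w))
  (isMeasurableFun.Build _ _ _ _ _ mf).
pose g : {RV P2 >-> R} := HB.pack (fun w => expR (c * (Y w + e)))
  (isMeasurableFun.Build _ _ _ _ _ mg).
have := @ge0_expectation_ccdf _ _ _ P1 f (fun w => expR_ge0 _).
have := @ge0_expectation_ccdf _ _ _ P2 g (fun w => expR_ge0 _).
rewrite !expectation_def => -> ->.
apply: ge0_le_integral => //=.
- by apply: measurable_funTS; exact: ccdf_measurable.
- by apply: measurable_funTS; exact: ccdf_measurable.
(* The endpoint [r = 0] has no logarithm; there the right tail equals 1. *)
move=> r; rewrite in_itv/= andbT le_eqVlt => /orP[/eqP <-|r0].
  have -> : ccdf g 0 = 1%E.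
    rewrite /ccdf /distribution /pushforward /=.
    rewrite (_ : _ @^-1` _ = setT) ?probability_setT//.
    by apply/seteqP; split => w //= _; rewrite in_itv/= andbT expR_gt0.
  exact: probability_le1.
rewrite /ccdf /distribution /pushforward /=.
pose t := ln r / c.
have rE : r = expR (c * t) by rewrite /t mulrC divfK ?gt_eqF// lnK.
have te : t - e < t by rewrite ltrBlDr ltrDl.
apply: le_trans (le_trans (XY _ _ te) _).
- apply: le_measure; rewrite ?inE.
  + by rewrite -[X in measurable X]setTI; exact: (mf).
  + rewrite (_ : [set _ | _] = X @^-1` `[t, +oo[%classic).
      by rewrite -[X in measurable X]setTI; exact: mX.
    by apply/seteqP; split => w /=; rewrite in_itv/= andbT.
  + move=> w /=; rewrite in_itv/= andbT rE ltr_expR ltr_pM2l//.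
    exact: ltW.
- apply: le_measure; rewrite ?inE.
  + rewrite (_ : [set _ | _] = Y @^-1` `]t - e, +oo[%classic).
      by rewrite -[X in measurable X]setTI; exact: mY.
    by apply/seteqP; split => w /=; rewrite in_itv/= andbT.
  + by rewrite -[X in measurable X]setTI; exact: (mg).
  + move=> w /=; rewrite in_itv/= andbT rE ltr_expR ltr_pM2l//.
    by rewrite ltrBlDr.
Qed.

End exponential_tail.

(** * Suprema of processes as limits along a dense sequence *)

Section supremum.
Context d (T : measurableType d) {R : realType} {K : finType} {U : Type}.
Variables (xi : K -> T -> R) (x : K -> U -> R) (S : set U).

(** A least-upper-bound property for each outcome, rather than a [sup], so that it passes easily to
    suprema that are rescaled or shifted by an added variable. *)
Definition is_sup_process (M : T -> R) := forall w,
  (forall a, S a -> process xi x a w <= M w) /\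
  (forall b, (forall a, S a -> process xi x a w <= b) -> M w <= b).

(** Density is measured through the coefficients [x k], which is what makes the values of the
    process close at every outcome. *)
Definition dense_seq (y : nat -> U) := (forall i, S (y i)) /\
  forall a, S a -> forall e : R, 0 < e ->
  exists i, forall k, `|x k a - x k (y i)| <= e.

Variables (y : nat -> U) (M : T -> R).
Hypotheses (dy : dense_seq y) (supM : is_sup_process M).

Lemma running_max_le_sup n w :
  running_max (fun i => process xi x (y i) w) n <= M w.
Proof. by apply: running_max_le => i _; apply: (supM w).1; exact: dy.1. Qed.

(** At a fixed outcome the process is Lipschitz in its coefficients, with constant the sum of the
    [|xi k w|]; hence no bound below [M w] can hold along [y]. *)
Lemma cvg_running_max_sup w :
  (fun n => running_max (fun i => process xi x (y i) w) n) @ \oo --> M w.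
Proof.
apply/cvgrPdist_le => e e0.
have [n Mn] : exists n, M w - e <= running_max (fun i => process xi x (y i) w)
  n.
  apply: contrapT => /forallNP h.
  have : M w <= M w - e; last by apply/negP; rewrite -ltNge ltrBlDr ltrDl.
  apply: (supM w).2 => a Sa; apply/ler_addgt0Pr => g g0.
  pose N := \sum_k `|xi k w| + 1.
  have N0 : 0 < N by rewrite ltr_wpDl// sumr_ge0.
  have [i ai] := dy.2 a Sa (g / N) (divr_gt0 g0 N0).
  have /negP := h i; rewrite -ltNge => hi.
  have yi := le_running_max (fun i => process xi x (y i) w) (leqnn i).
  have : process xi x a w - process xi x (y i) w <= g; last first.
    by move: hi yi; rewrite /=; lra.
  rewrite /process -sumrB.
  apply: (@le_trans _ _ (\sum_k `|xi k w| * (g / N))).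
    apply: ler_sum => k _; rewrite -mulrBr (le_trans (ler_norm _))// normrM.
    by rewrite ler_wpM2l.
  rewrite -mulr_suml mulrCA ler_piMr ?(ltW g0)//.
  by rewrite ler_pdivrMr// mul1r lerDl.
near=> p; have np : (n <= p)%N by near: p; exact: nbhs_infty_ge.
rewrite ger0_norm ?subr_ge0 ?running_max_le_sup// lerBlDr -lerBlDl.
exact: le_trans Mn (running_max_mono _ np).
Unshelve. all: by end_near. Qed.

Lemma measurable_sup_process : (forall k, measurable_fun setT (xi k)) ->
  measurable_fun setT M.
Proof.
move=> mxi; apply: (measurable_fun_cvg
  (h := fun n w => running_max (fun i => process xi x (y i) w) n)) => [n|w _].
  by apply: measurable_running_max => i; exact: measurable_process.
exact: cvg_running_max_sup.
Qed.

End supremum.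

(** * Slepian's comparison for suprema *)

Section slepian_sup.
Context d1 d2 (T1 : measurableType d1) (T2 : measurableType d2) {R : realType}.
Variables (P1 : probability T1 R) (P2 : probability T2 R).
Context {K1 K2 : finType} {U : Type}.

(** Finite maxima are compared with slack [e]; on the left they increase to [M1] by monotone
    convergence, on the right they stay below [M2], and finally [e] tends to 0. *)
Lemma slepian_sup (xi1 : K1 -> T1 -> R) (xi2 : K2 -> T2 -> R)
    (x1 : K1 -> U -> R) (x2 : K2 -> U -> R) (S : set U) (y : nat -> U)
    (M1 : T1 -> R) (M2 : T2 -> R) (c : R) :
  (forall k, measurable_fun setT (xi1 k)) ->
  (forall k, measurable_fun setT (xi2 k)) ->
  gauss_indep P1 xi1 setT (enum K1) -> gauss_indep P2 xi2 setT (enum K2) ->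
  (forall a, S a -> covariance_of x1 a a = covariance_of x2 a a) ->
  (forall a b, S a -> S b -> covariance_of x2 a b <= covariance_of x1 a b) ->
  dense_seq x1 S y -> dense_seq x2 S y ->
  is_sup_process xi1 x1 S M1 -> is_sup_process xi2 x2 S M2 -> 0 < c ->
  (\int[P1]_w (expR (c * M1 w))%:E <= \int[P2]_w (expR (c * M2 w))%:E)%E.
Proof.
move=> m1 m2 i1 i2 vE cL d1y d2y s1 s2 c0.
have yS := d1y.1.
pose max1 n w := running_max (fun i => process xi1 x1 (y i) w) n.
pose max2 n w := running_max (fun i => process xi2 x2 (y i) w) n.
have mmax1 n : measurable_fun setT (max1 n).
  by apply: measurable_running_max => i; exact: measurable_process.
have mmax2 n : measurable_fun setT (max2 n).
  by apply: measurable_running_max => i; exact: measurable_process.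
have mM2 : measurable_fun setT M2 by exact: measurable_sup_process d2y s2 m2.
have mexp d (T : measurableType d) (M : T -> R) (e : R) : measurable_fun setT M
  ->
    measurable_fun setT (fun w => (expR (c * (M w + e)))%:E).
  move=> mM; apply/measurable_EFinP/(measurableT_comp (@measurable_expR R)).
  by apply: measurable_funM => //; exact: measurable_funD.
have mexp0 d (T : measurableType d) (M : T -> R) : measurable_fun setT M ->
    measurable_fun setT (fun w => (expR (c * M w))%:E).
  move=> mM; apply/measurable_EFinP/(measurableT_comp (@measurable_expR R)).
  exact: measurable_funM.
have step e : 0 < e -> (\int[P1]_w (expR (c * M1 w))%:E <=
    (expR (c * e))%:E * \int[P2]_w (expR (c * M2 w))%:E)%E.
  move=> e0.
  have ub n : (\int[P1]_w (expR (c * max1 n w))%:E <=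
      (expR (c * e))%:E * \int[P2]_w (expR (c * M2 w))%:E)%E.
    apply: (le_trans (le_integral_expR_tail (mmax1 n) (mmax2 n) c0 e0
      (fun s t => slepian_tail m1 m2 i1 i2 (fun i => vE _ (yS i))
        (fun i j => cL _ _ (yS i) (yS j)) n (s := s) (t := t)))).
    rewrite -ge0_integralZl//; last exact: mexp0.
    apply: ge0_le_integral => //.
    - exact: mexp.
    - by apply: emeasurable_funM => //; exact: mexp0.
    - move=> w _; rewrite -EFinM lee_fin -expRD ler_expR -mulrDr ler_pM2l//.
      by rewrite addrC lerD2l; exact: running_max_le_sup d2y s2 n w.
  have cvgI : (\int[P1]_w (expR (c * max1 n w))%:E @[n --> \oo] -->
      \int[P1]_w (expR (c * M1 w))%:E)%E.
    rewrite (_ : (\int[P1]_w (expR (c * M1 w))%:E =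
        \int[P1]_w limn (fun n => (expR (c * max1 n w))%:E))%E).
      apply: cvg_monotone_convergence => //.
      - by move=> n; exact: mexp0.
      - move=> w _ n p np; rewrite lee_fin ler_expR ler_pM2l//.
        exact: running_max_mono.
    apply: eq_integral => w _; apply/esym/cvg_lim => //.
    apply: cvg_EFin; first by near=> n.
    apply: (cvg_comp _ expR); last exact: continuous_expR.
    by apply: cvgMr; exact: (cvg_running_max_sup d1y s1).
  rewrite -(cvg_lim _ cvgI)//; apply: lime_le; first exact: cvgP cvgI.
  by apply: nearW => n; exact: ub.
have b0 : (0 <= \int[P2]_w (expR (c * M2 w))%:E)%E.
  by apply: integral_ge0 => w _; rewrite lee_fin expR_ge0.
move: step b0; case: (\int[P2]_w _)%E => [b step|_ _|_ //]; last by rewrite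
  leey.
rewrite lee_fin => b0; apply/lee_addgt0Pr => e e0.
have q0 : 0 < e / (b + 1) by rewrite divr_gt0// ltr_wpDl.
have q1 : 1 < 1 + e / (b + 1) by rewrite ltrDl.
(* This slack makes the factor [expR (c * _)] equal to [1 + e / (b + 1)], so the excess over [b] is
   at most [e]. *)
apply: (le_trans (step (ln (1 + e / (b + 1)) / c) _)).
  by rewrite divr_gt0// ln_gt0.
rewrite mulrC divfK ?gt_eqF// lnK ?posrE ?(lt_trans _ q1)//.
rewrite -EFinM -EFinD lee_fin mulrDl mul1r lerD2l mulrAC ler_pdivrMr
  ?ltr_wpDl//.
by rewrite ler_wpM2l ?ltW// ltrDl.
Unshelve. all: by end_near. Qed.

End slepian_sup.

(** * Product laws from mutual independence *)

Section mutually_independent_gauss.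
Context d (T : measurableType d) {R : realType} (P : probability T R).

(** An injective [h] selects a finite subfamily; enumerating [K] by ordinals matches the indexing of
    [mutually_independent]. *)
Lemma mutually_independent_gauss_indep (I : Type) (X : I -> T -> R)
    (K : finType) (h : K -> I) :
  mutually_independent P X -> injective h ->
  (forall k, std_normal P (X (h k))) ->
  gauss_indep P (fun k => X (h k)) setT (enum K).
Proof.
move=> indX hinj stdX B mB; rewrite setTI probability_setT mul1e.
have idx_inj : injective (fun i : 'I_#|K| => h (enum_val i)).
  by move=> i j /hinj /enum_val_inj.
have := indX _ _ idx_inj (fun i => B (enum_val i)) (fun i => mB _).
rewrite !big_enum/=.
rewrite (_ : \bigcap_(i in [set: 'I_#|K|]) _ =
    \big[setI/setT]_k (X (h k) @^-1` B k)); last first.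
  rewrite (reindex_onto (@enum_val K predT) enum_rank) /=; last first.
    by move=> k _; rewrite enum_rankK.
  rewrite (eq_bigl predT); last by move=> i; rewrite enum_valK eqxx.
  rewrite -bigcap_seq; apply: eq_bigcapl.
  by split => i //= _; exact: mem_index_enum.
move=> ->; rewrite [RHS](reindex_onto (@enum_val K predT) enum_rank) /=; last
  first.
  by move=> k _; rewrite enum_rankK.
rewrite [RHS](eq_bigl predT); last by move=> i; rewrite enum_valK eqxx.
by apply: eq_bigr => i _; exact: (stdX _).2.
Qed.

(** Adjoins one more independent normal as a second coordinate: the joint events are rectangles of
    the product measure. *)
Lemma gauss_indep_prod (K : finType) (xi : K -> T -> R) :
  (forall k, measurable_fun setT (xi k)) ->
  gauss_indep P xi setT (enum K) ->
  gauss_indep (P \x (@normal_prob R 0 1))%E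
    (fun (k : K + unit) (wz : T * R) =>
       match k with inl k => xi k wz.1 | inr _ => wz.2 end)
    setT (enum {: K + unit}).
Proof.
move=> mxi ixi B mB; rewrite setTI probability_setT mul1e.
have := ixi (fun k => B (inl k)) (fun k => mB _).
rewrite setTI probability_setT mul1e !big_enum/= !big_sumType/=.
rewrite (big_pred1 tt)/=; last by case.
rewrite [X in _ -> _ = (_ * X)%E](big_pred1 tt)/=; last by case.
have mI : measurable (\big[setI/setT]_k (xi k @^-1` B (inl k))).
  rewrite -bigcap_seq; apply: fin_bigcap_measurable => //= k _.
  by rewrite -[X in measurable X]setTI; exact: mxi.
move=> e; rewrite -e -(product_measure1E P (normal_prob 0 1) mI (mB _)).
congr (_ _); rewrite -!bigcap_seq; apply/seteqP; split.
  by move=> [w z] [/= h1 h2]; split => //= k kK; exact: h1.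
by move=> [w z] [/= h1 h2]; split => //= k kK; exact: h1.
Qed.

End mutually_independent_gauss.

(** * Unit vectors and elementary inequalities *)

Section sphere.
Context {R : realType} {n : nat}.
Implicit Types v w : 'I_n -> R.

Lemma sphere_coord v i : sphere v -> `|v i| <= 1.
Proof.
rewrite /sphere /= => v1; rewrite -ler_sqr ?nnegrE//.
rewrite expr1n real_normK ?num_real// -v1 (bigD1 i)//= lerDl.
by apply: sumr_ge0 => j _; exact: sqr_ge0.
Qed.

Lemma sphere_inner v w : sphere v -> sphere w ->
  `|\sum_(i < n) v i * w i| <= 1.
Proof.
rewrite /sphere /= => v1 w1; apply: (le_trans (ler_norm_sum _ _ _)).
have : (\sum_(i < n) `|v i * w i|) * 2 <=
    \sum_(i < n) v i ^+ 2 + \sum_(i < n) w i ^+ 2.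
  rewrite -big_split/= mulr_suml; apply: ler_sum => i _.
  have := sqr_ge0 (`|v i| - `|w i|).
  by rewrite sqrrB !real_normK ?num_real// normrM; lra.
by rewrite v1 w1; lra.
Qed.

Lemma sphere_inner1 v : sphere v -> \sum_(i < n) v i * v i = 1.
Proof. by rewrite /sphere /= => <-; apply: eq_bigr => i _; rewrite expr2. Qed.

End sphere.

Section elementary.
Context {R : realType}.

Lemma norm_prod_le1 (I : Type) (r : seq I) (a : I -> R) :
  (forall i, `|a i| <= 1) -> `|\prod_(i <- r) a i| <= 1.
Proof.
move=> a1; elim: r => [|i r ih]; first by rewrite big_nil normr1.
by rewrite big_cons normrM mulr_ile1.
Qed.

(** Factors are exchanged one at a time; the remaining ones have modulus at most 1. *)
Lemma prod_lipschitz (I : Type) (r : seq I) (a b : I -> R) :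
  (forall i, `|a i| <= 1) -> (forall i, `|b i| <= 1) ->
  `|\prod_(i <- r) a i - \prod_(i <- r) b i| <= \sum_(i <- r) `|a i - b i|.
Proof.
move=> a1 b1; elim: r => [|i r ih].
  by rewrite !big_nil subrr normr0.
rewrite !big_cons; set x := \prod_(j <- r) a j; set y := \prod_(j <- r) b j.
have -> : a i * x - b i * y = (a i - b i) * y + a i * (x - y) by ring.
apply: (le_trans (ler_normD _ _)); rewrite !normrM lerD//.
  by rewrite ler_piMr// norm_prod_le1.
by apply: le_trans ih; rewrite ler_piMl.
Qed.

(** Induction on the number of factors: with [q] the product so far and [t] the new factor,
    [(1 - q) * (1 - t) >= 0] gives [q + t <= q * t + 1]. *)
Lemma sum_le_prod (p : nat) (a : 'I_p -> R) : (0 < p)%N ->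
  (forall i, `|a i| <= 1) -> \sum_i a i <= \prod_i a i + (p%:R - 1).
Proof.
case: p a => // p a _; rewrite -natr1 addrK.
elim: p a => [|p ih] a a1; first by rewrite !big_ord1 addr0.
rewrite big_ord_recr [X in _ <= X + _]big_ord_recr /=.
set s := \sum_(i < p.+1) _; set q := \prod_(i < p.+1) _; set t := a ord_max.
have h : s <= q + p%:R by apply: ih => i; exact: a1.
have q1 : `|q| <= 1 by apply: norm_prod_le1 => i; exact: a1.
have t1 : `|t| <= 1 := a1 _.
have : 0 <= (1 - q) * (1 - t).
  by rewrite mulr_ge0// subr_ge0 (le_trans (ler_norm _)).
by rewrite -natr1; nra.
Qed.

(** AM-GM for the numbers [a i ^+ p], nonnegative because [p] is even; the two sides are compared
    through their [p]-th powers. *)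
Lemma prod_le_mean_pow (p : nat) (a : 'I_p -> R) : (0 < p)%N -> ~~ odd p ->
  \prod_i a i <= (\sum_i a i ^+ p) / p%:R.
Proof.
move=> p0 podd; apply: (le_trans (ler_norm _)); rewrite normr_prod.
have S0 : 0 <= (\sum_i a i ^+ p) / p%:R.
  by rewrite divr_ge0// sumr_ge0// => i _; exact: exprn_even_ge0.
rewrite -(@ler_pXn2r _ p)// ?nnegrE ?prodr_ge0//.
have := @leif_AGM R _ predT (fun i : 'I_p => a i ^+ p).
rewrite /= card_ord => h.
have [+ _] := h (fun i _ => exprn_even_ge0 (a i) podd).
apply: le_trans; rewrite le_eqVlt -prodrXl; apply/orP; left; apply/eqP.
apply: eq_bigr => i _; rewrite -normrX ger0_norm//.
exact: exprn_even_ge0.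
Qed.

End elementary.

(** * The three processes indexed by the product of the sets *)

Section tensor_process.
Context {R : realType} {n p : nat}.
Implicit Types (a b : 'I_p -> 'I_n -> R) (S : 'I_p -> set ('I_n -> R)).

Definition product_set S : set ('I_p -> 'I_n -> R) := [set a | forall j, S j (a
  j)].

Lemma exists_dense_seq (D : set ('I_p -> 'I_n -> R)) : D !=set0 ->
  exists y : nat -> 'I_p -> 'I_n -> R, (forall i, D (y i)) /\
  forall a, D a -> forall e : R, 0 < e ->
  exists i, forall j k, `|a j k - y i j k| <= e.
Proof.
move=> [a0 Da0].
(* One point in each nonempty cell of the grid of mesh [1 / (N + 1)]. *)
pose cell (q : nat * {ffun 'I_p * 'I_n -> int}) a :=
  forall j k, Num.floor (q.1.+1%:R * a j k) = q.2 (j, k).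
have /choice[h hP] : forall q, exists a, D a /\
    forall b, D b -> cell q b -> cell q a.
  move=> q; have [[b [Db qb]]|nq] := pselect (exists b, D b /\ cell q b).
    by exists b; split.
  by exists a0; split => // b Db qb; exfalso; apply: nq; exists b.
(* Cells are countable through their codes; a number that codes no cell is sent to [a0]. *)
exists (fun m => if unpickle m is Some q then h q else a0); split.
  by move=> i; case: unpickle => // q; exact: (hP q).1.
move=> a Da e e0.
pose N := Num.truncn e^-1.
pose q : nat * {ffun 'I_p * 'I_n -> int} :=
  (N, [ffun jk => Num.floor (N.+1%:R * a jk.1 jk.2)]).
exists (pickle q) => j k; rewrite pickleK.
have qa : cell q a by move=> j' k'; rewrite ffunE.
have := (hP q).2 a Da qa j k; rewrite -(qa j k) /=.
set b := h q j k => fl.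
have N0 : 0 < N.+1%:R :> R by rewrite ltr0n.
have Ne : e^-1 < N.+1%:R by exact: truncnS_gt.
(* Both scaled coordinates have the same integer part. *)
have : `|N.+1%:R * a j k - N.+1%:R * b| <= 1.
  have := floor_itv (N.+1%:R * a j k); have := floor_itv (N.+1%:R * b).
  by rewrite fl intrD ler_norml => /andP[? ?] /andP[? ?]; apply/andP; split;
    lra.
rewrite -mulrBr normrM (gtr0_norm N0) mulrC -ler_pdivlMr// mul1r => h1.
by apply: (le_trans h1); rewrite -[leRHS]invrK lef_pV2 ?posrE ?invr_gt0// ltW.
Qed.

Definition tensor_coef (i : midx n p) a : R := \prod_(j < p) a j (i j).

Definition vector_coef (ji : 'I_p * 'I_n) a : R := a ji.1 ji.2.

Definition power_coef (ji : 'I_p * midx n p) a : R :=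
  \prod_(k < p) a ji.1 (ji.2 k).

(** Expanding the product of the inner products gives one term per multi-index. *)
Lemma tensor_covariance a b : covariance_of tensor_coef a b =
  \prod_(j < p) \sum_(i < n) a j i * b j i.
Proof.
rewrite bigA_distr_bigA/=; apply: eq_bigr => i _.
by rewrite /tensor_coef -big_split.
Qed.

Lemma vector_covariance a b : covariance_of vector_coef a b =
  \sum_(j < p) \sum_(i < n) a j i * b j i.
Proof. by rewrite pair_bigA. Qed.

Lemma power_covariance a b : covariance_of power_coef a b =
  \sum_(j < p) (\sum_(i < n) a j i * b j i) ^+ p.
Proof.
rewrite /covariance_of -(pair_bigA _ (fun j i => power_coef (j, i) a *
  power_coef (j, i) b))/=.
apply: eq_bigr => j _.
rewrite -[in RHS](card_ord p) -prodr_const bigA_distr_bigA/=.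
by apply: eq_bigr => i _; rewrite /power_coef -big_split.
Qed.

Variable S : 'I_p -> set ('I_n -> R).
Hypothesis Ssphere : forall j, S j `<=` @sphere R n.
Hypothesis Sn0 : forall j, S j !=set0.

Let coord1 a : product_set S a -> forall j i, `|a j i| <= 1.
Proof. by move=> Sa j i; apply: sphere_coord; exact/Ssphere. Qed.

Lemma product_set_neq0 : product_set S !=set0.
Proof.
have /choice[h hP] : forall j, exists v, S j v by move=> j; exact: Sn0.
by exists h.
Qed.

Definition coord_dense (y : nat -> 'I_p -> 'I_n -> R) :=
  (forall i, product_set S (y i)) /\
  forall a, product_set S a -> forall e : R, 0 < e ->
  exists i, forall j k, `|a j k - y i j k| <= e.

Lemma dense_seq_lipschitz (K : finType) (x : K -> ('I_p -> 'I_n -> R) -> R) y :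
  coord_dense y ->
  (forall k a b e, product_set S a -> product_set S b ->
    (forall j i, `|a j i - b j i| <= e) -> `|x k a - x k b| <= p%:R * e) ->
  dense_seq x (product_set S) y.
Proof.
move=> [yS yd] xl; split=> // a Sa e e0.
have [i yi] := yd a Sa (e / (p%:R + 1)) (divr_gt0 e0 (ltr_wpDl (ler0n _ _)
  ltr01)).
exists i => k; apply: (le_trans (xl k _ _ _ Sa (yS i) yi)).
rewrite mulrCA ler_piMr ?(ltW e0)// ler_pdivrMr ?mul1r ?lerDl//.
Qed.

(** The map [f] names the entry used by each factor, so that one bound covers both [tensor_coef] and
    [power_coef]. *)
Lemma prod_coef_lipschitz (f : 'I_p -> 'I_p * 'I_n) a b e :
  product_set S a -> product_set S b ->
  (forall j i, `|a j i - b j i| <= e) ->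
  `|\prod_(k < p) a (f k).1 (f k).2 - \prod_(k < p) b (f k).1 (f k).2|
    <= p%:R * e.
Proof.
move=> Sa Sb ab; apply: (le_trans (prod_lipschitz _ (fun k => coord1 Sa _ _)
  (fun k => coord1 Sb _ _))).
rewrite -[p in leRHS]card_ord mulr_natl -sumr_const.
exact: ler_sum.
Qed.

(** Bounded coefficients and a nonempty index set make [sup] a genuine least upper bound. *)
Lemma is_sup_process_maxS d (T : measurableType d) (K : finType)
    (xi : K -> T -> R) (x : K -> ('I_p -> 'I_n -> R) -> R) :
  (forall k a, product_set S a -> `|x k a| <= 1) ->
  is_sup_process xi x (product_set S)
    (fun w => maxS S (fun a => process xi x a w)).
Proof.
move=> x1 w; rewrite /maxS -/(product_set S).
have [a0 Sa0] := product_set_neq0.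
have ub : has_ubound [set process xi x a w | a in product_set S].
  exists (\sum_k `|xi k w|) => _ [a Sa <-]; apply: ler_sum => k _.
  rewrite (le_trans (ler_norm _))// normrM ler_piMr//; exact: x1.
split=> [a Sa|b hb].
  by apply: ub_le_sup => //; exists a.
apply: ge_sup; first by exists (process xi x a0 w), a0.
by move=> _ [a Sa <-]; exact: hb.
Qed.

End tensor_process.

(** * Normalised logarithms of moments *)

Section log_moment.
Context {R : realType}.

Lemma log_moment_le (k c : R) (a b : \bar R) : 0 <= k -> 0 < c ->
  (0 <= a)%E -> (a <= b)%E ->
  (k%:E * (c^-1%:E * lne a) <= k%:E * (c^-1%:E * lne b))%E.
Proof.
move=> k0 c0 a0 ab; apply: lee_wpmul2l; rewrite ?lee_fin//.
apply: lee_wpmul2l; first by rewrite lee_fin invr_ge0 ltW.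
by rewrite lee_lne// in_itv/= leey andbT// (le_trans a0).
Qed.

(** The logarithm turns the factor [expR q] into a summand; a zero [a] and an infinite [b] are
    settled by the extended values. *)
Lemma log_moment_shift_le (k c q : R) (a b : \bar R) : 0 <= k -> 0 < c ->
  (0 <= a)%E -> ((expR q)%:E * a <= b)%E ->
  (k%:E * (c^-1%:E * lne a) <= k%:E * ((- (c^-1 * q))%:E + c^-1%:E * lne b))%E.
Proof.
move=> k0 c0 a0 ab; apply: lee_wpmul2l; rewrite ?lee_fin//.
have ci : 0 < c^-1 by rewrite invr_gt0.
case: b ab => [b| |] ab.
- case: a a0 ab => [a| |]//; rewrite ?gt0_muley ?lte_fin ?expR_gt0//.
  rewrite lee_fin le_eqVlt => /orP[/eqP <- _|a0].
    by rewrite /= lexx gt0_muleNy ?lte_fin// leNye.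
  rewrite -EFinM lee_fin => ab.
  have b0 : 0 < b by rewrite (lt_le_trans _ ab)// mulr_gt0// expR_gt0.
  rewrite !lne_EFin// -!EFinM -EFinD lee_fin -mulrN -mulrDr ler_pM2l//.
  by rewrite -lerBlDl opprK addrC -[q]expRK -lnM ?posrE ?expR_gt0// ler_ln
    ?posrE// mulr_gt0 ?expR_gt0.
- by rewrite /= gt0_muley ?lte_fin// addey// leey.
- have : (0 <= -oo :> \bar R)%E; last by [].
  by apply: le_trans ab; rewrite mule_ge0// lee_fin expR_ge0.
Qed.

End log_moment.

(** * The upper and lower comparisons of exponential moments *)

Section tensor_comparison.
Context d (T : measurableType d) {R : realType} (P : probability T R) {n p :
  nat}.
Variable S : 'I_p -> set ('I_n -> R).
Hypothesis p_gt0 : (0 < p)%N.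
Hypothesis Ssphere : forall j, S j `<=` @sphere R n.
Hypothesis Sn0 : forall j, S j !=set0.
Variable A : midx n p -> T -> R.
Hypothesis mA : forall i, measurable_fun setT (A i).
Hypothesis iA : gauss_indep P A setT (enum {: midx n p}).

Let phiA w := phi S (fun i => A i w).

Let coord1 a : product_set S a -> forall j i, `|a j i| <= 1.
Proof. by move=> Sa j i; apply: sphere_coord; exact/Ssphere. Qed.

Let tensor_coef1 i a : product_set S a -> `|tensor_coef i a| <= 1.
Proof. by move=> Sa; apply: norm_prod_le1 => j; exact: coord1. Qed.

Let tensor_dense y : coord_dense S y -> dense_seq tensor_coef (product_set S) y.
Proof.
move=> dy; apply: dense_seq_lipschitz => // i a b e Sa Sb ab.
exact: (prod_coef_lipschitz Ssphere (fun k => (k, i k)) Sa Sb ab).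
Qed.

Let is_sup_phi : is_sup_process A tensor_coef (product_set S) phiA.
Proof. by apply: is_sup_process_maxS => // i a; exact: tensor_coef1. Qed.

Let inner1 a : product_set S a -> forall j, \sum_(i < n) a j i * a j i = 1.
Proof. by move=> Sa j; apply: sphere_inner1; exact/Ssphere. Qed.

Let inner_le1 a b : product_set S a -> product_set S b ->
  forall j, `|\sum_(i < n) a j i * b j i| <= 1.
Proof. by move=> Sa Sb j; apply: sphere_inner; exact/Ssphere. Qed.

Lemma upper_comparison (G : 'I_p -> 'I_n -> T -> R) (c : R) :
  (forall j i, measurable_fun setT (G j i)) ->
  gauss_indep P (fun ji : 'I_p * 'I_n => G ji.1 ji.2) setT
    (enum {: 'I_p * 'I_n}) -> 0 < c ->
  ((expR (c ^+ 2 * (p%:R - 1) / 2))%:E *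
     \int[P]_w (expR (c * phiA w))%:E <=
   \int[P]_w (expR (c * phi_u S (fun j i => G j i w)))%:E)%E.
Proof.
move=> mG iG c0.
have [y dy] : exists y, coord_dense S y.
  exact: (exists_dense_seq (product_set_neq0 Sn0)).
pose s : R := Num.sqrt (p%:R - 1).
have p1 : 0 <= p%:R - 1 :> R by rewrite subr_ge0 ler1n.
(* The auxiliary Gaussian is the second factor of [P \x normal_prob 0 1]. *)
pose xi1 (k : midx n p + unit) (wz : T * measurableTypeR R) : R :=
  match k with inl k => A k wz.1 | inr _ => wz.2 end.
pose x1 (k : midx n p + unit) (a : 'I_p -> 'I_n -> R) : R :=
  match k with inl k => tensor_coef k a | inr _ => s end.
pose M1 (wz : T * measurableTypeR R) : R := phiA wz.1 + wz.2 * s.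
pose xi2 (ji : 'I_p * 'I_n) := G ji.1 ji.2.
have cov1 a b : covariance_of x1 a b =
    \prod_(j < p) (\sum_(i < n) a j i * b j i) + (p%:R - 1).
  rewrite /covariance_of big_sumType/= (big_pred1 tt)/=; last by case.
  rewrite -expr2 sqr_sqrtr//; congr (_ + _); exact: tensor_covariance.
have procE a wz : process xi1 x1 a wz = process A tensor_coef a wz.1 + wz.2 * s.
  by rewrite /process big_sumType/= (big_pred1 tt)//; case.
have phiuE w : phi_u S (fun j i => G j i w) =
    maxS S (fun a => process xi2 vector_coef a w).
  congr (maxS S _); apply/funext => a; rewrite pair_bigA; exact: eq_bigr.
have mphi : measurable_fun setT phiA.
  exact: measurable_sup_process (tensor_dense dy) is_sup_phi mA.
(* By Tonelli the added Gaussian splits off its own exponential moment, which is the factor on the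
   left. *)
apply: (@le_trans _ _ (\int[P \x (@normal_prob R 0 1)]_wz
    (expR (c * M1 wz))%:E)%E).
  pose f (wz : T * R) := (expR (c * M1 wz))%:E.
  have mf : measurable_fun setT f.
    apply/measurable_EFinP/(measurableT_comp (@measurable_expR R)).
    apply: measurable_funM => //; apply: measurable_funD.
      exact: (measurableT_comp mphi).
    exact: measurable_funM.
  have f0 wz : (0 <= f wz)%E by rewrite lee_fin expR_ge0.
  rewrite [leRHS](@fubini_tonelli1 _ _ T (measurableTypeR R) R P
    (normal_prob 0 1) f mf f0).
  rewrite -ge0_integralZl//; last first.
    apply/measurable_EFinP/(measurableT_comp (@measurable_expR R)).
    exact: measurable_funM.
  rewrite le_eqVlt; apply/orP; left; apply/eqP.
  apply: eq_integral => w _; rewrite /fubini_F /f /M1 /=.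
  rewrite [RHS](_ : _ = \int[normal_prob 0 1]_z
      ((expR (c * phiA w))%:E * (expR ((c * s) * (z : R)))%:E))%E; last first.
    by apply: eq_integral => z _; rewrite -EFinM -expRD; congr (expR _)%:E;
      ring.
  rewrite ge0_integralZl//.
  - rewrite integral_normal_expR muleC; congr (_ * (expR _)%:E)%E.
    by rewrite exprMn sqr_sqrtr.
  - apply/measurable_EFinP/(measurableT_comp (@measurable_expR R)).
    exact: measurable_funM.
pose U := 'I_p -> 'I_n -> R.
apply: (@slepian_sup _ _ (T * measurableTypeR R)%type T R
  (P \x (@normal_prob R 0 1))%E P _ _ U xi1 xi2 x1 vector_coef (product_set S) y
  M1 (fun w => phi_u S (fun j i => G j i w)) c) => //.
- case=> [k|u]; last exact: measurable_snd.
  exact: (measurableT_comp (mA k)).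
- by move=> [j i]; exact: mG.
- exact: (gauss_indep_prod mA iA).
(* Both variances equal [p]: on the left [1 + (p - 1)], on the right [p] unit inner products. *)
- move=> a Sa; rewrite cov1 vector_covariance.
  rewrite big1; last by move=> j _; exact: inner1.
  rewrite (eq_bigr (fun=> 1)); last by move=> j _; exact: inner1.
  by rewrite sumr_const card_ord addrC subrK.
- move=> a b Sa Sb; rewrite cov1 vector_covariance.
  exact: sum_le_prod (inner_le1 Sa Sb).
- have [yS yd] := tensor_dense dy; split=> // a Sa e e0.
  have [i yi] := yd a Sa e e0; exists i; case=> [k|[]]; first exact: yi.
  by rewrite /x1 subrr normr0 ltW.
- split; first exact: dy.1.
  move=> a Sa e e0; have [i yi] := dy.2 a Sa e e0.
  by exists i => -[j k]; exact: yi.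
- move=> wz; split=> [a Sa|b hb].
    by rewrite procE lerD2r; exact: (is_sup_phi wz.1).1.
  rewrite -lerBrDr; apply: (is_sup_phi wz.1).2 => a Sa.
  by rewrite lerBrDr -procE; exact: hb.
- move=> w; rewrite phiuE; apply: is_sup_process_maxS => // -[j k] a Sa.
  exact: coord1.
Qed.

Lemma lower_comparison (B : 'I_p -> midx n p -> T -> R) (c : R) :
  (forall j i, measurable_fun setT (B j i)) -> ~~ odd p ->
  gauss_indep P (fun ji : 'I_p * midx n p => B ji.1 ji.2) setT
    (enum {: 'I_p * midx n p}) -> 0 < c ->
  (\int[P]_w (expR (c / Num.sqrt p%:R * phi_l S (fun j i => B j i w)))%:E <=
   \int[P]_w (expR (c * phiA w))%:E)%E.
Proof.
move=> mB podd iB c0.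
have [y dy] : exists y, coord_dense S y.
  exact: (exists_dense_seq (product_set_neq0 Sn0)).
(* This normalisation brings the variance of the [p] independent tensor forms down to 1, that of the
   single form. *)
pose s : R := (Num.sqrt p%:R)^-1.
have pR : 0 < p%:R :> R by rewrite ltr0n.
have s0 : 0 < s by rewrite invr_gt0 sqrtr_gt0.
have s2 : s ^+ 2 = p%:R^-1 by rewrite exprVn sqr_sqrtr// ltW.
pose xi1 (ji : 'I_p * midx n p) := B ji.1 ji.2.
pose x1 (ji : 'I_p * midx n p) a : R := s * power_coef ji a.
have cov1 a b : covariance_of x1 a b =
    (\sum_(j < p) (\sum_(i < n) a j i * b j i) ^+ p) / p%:R.
  rewrite -s2 mulrC -power_covariance /covariance_of mulr_sumr.
  by apply: eq_bigr => k _; rewrite /x1; ring.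
have procE a w : process xi1 x1 a w = s * process xi1 power_coef a w.
  by rewrite /process mulr_sumr; apply: eq_bigr => k _; rewrite /x1; ring.
have philE w : phi_l S (fun j i => B j i w) =
    maxS S (fun a => process xi1 power_coef a w).
  congr (maxS S _); apply/funext => a; rewrite pair_bigA; exact: eq_bigr.
under eq_integral do rewrite -mulrA -/s.
apply: (slepian_sup (xi1 := xi1) (x1 := x1) (x2 := tensor_coef) (y := y)
  (S := product_set S)
  (M1 := fun w => s * phi_l S (fun j i => B j i w)) _ mA iB iA) => //.
- by move=> [j i]; exact: mB.
- move=> a Sa; rewrite cov1 tensor_covariance.
  rewrite [RHS]big1; last by move=> j _; exact: inner1.
  rewrite (eq_bigr (fun=> 1)); last by move=> j _; rewrite inner1// expr1n.
  by rewrite sumr_const card_ord divff// gt_eqF.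
- move=> a b Sa Sb; rewrite cov1 tensor_covariance.
  exact: prod_le_mean_pow.
- apply: dense_seq_lipschitz => // -[j i] a b e Sa Sb ab.
  (* As [s <= 1], the scaled coefficients keep the Lipschitz constant [p]. *)
  rewrite -mulrBr normrM.
  apply: le_trans (prod_coef_lipschitz Ssphere (fun k => (j, i k)) Sa Sb ab).
  rewrite ler_piMl// (gtr0_norm s0) invf_le1 ?sqrtr_gt0//.
  by rewrite -[leLHS]sqrtr1 ler_sqrt ?ler0n ?ler1n.
- exact: tensor_dense.
- have sup1 : is_sup_process xi1 power_coef (product_set S)
      (fun w => phi_l S (fun j i => B j i w)).
    move=> w; rewrite philE; apply: is_sup_process_maxS => // -[j i] a Sa.
    by apply: norm_prod_le1 => k; exact: coord1.
  move=> w; split=> [a Sa|b hb].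
    by rewrite procE ler_pM2l//; exact: (sup1 w).1.
  rewrite -ler_pdivlMl//; apply: (sup1 w).2 => a Sa.
  by rewrite ler_pdivlMl// -procE; exact: hb.
Qed.

End tensor_comparison.

(** * Assembly of the two bounds *)

Unset Implicit Arguments.

Theorem theorem1 (d : measure_display) (T : measurableType d) (R : realType)
  (P : probability T R) (n p : nat)
  (A : {ffun 'I_p -> 'I_n} -> T -> R) (g : T -> R)
  (G : 'I_p -> 'I_n -> T -> R) (B : 'I_p -> {ffun 'I_p -> 'I_n} -> T -> R)
  (S : 'I_p -> set ('I_n -> R)) :
  (0 < p)%N -> ~~ odd p ->
  (forall i, std_normal P (A i)) ->
  std_normal P g ->
  (forall j i, std_normal P (G j i)) ->
  (forall j i, std_normal P (B j i)) ->
  mutually_independent P (all_rv A g G B) ->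
  (forall j, S j `<=` @sphere R n) ->
  (forall j, S j !=set0) ->
  forall c3l c3u : R, 0 < c3l -> 0 < c3u ->
  (xi_l P S B c3l <= xi P S A c3l)%E /\ (xi P S A c3u <= xi_u P S G c3u)%E.
Proof.
move=> p0 podd stdA _ stdG stdB ind Ssph Sn0 c3l c3u c3l0 c3u0.
have mA i : measurable_fun setT (A i) := (stdA i).1.
have iA : gauss_indep P A setT (enum {: {ffun 'I_p -> 'I_n}}).
  apply: (mutually_independent_gauss_indep
    (h := fun i => inl (inl (inl i)) : all_index n p) ind) => //.
  by move=> i j [].
have iG : gauss_indep P (fun ji : 'I_p * 'I_n => G ji.1 ji.2) setT
    (enum {: 'I_p * 'I_n}).
  rewrite (_ : (fun ji => _) = fun ji => all_rv A g G B (inl (inr ji))).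
    apply: (mutually_independent_gauss_indep
      (h := fun i => inl (inr i) : all_index n p) ind) => [i j []//|[j i]].
    exact: stdG.
  by apply/funext => -[].
have iB : gauss_indep P (fun ji : 'I_p * {ffun 'I_p -> 'I_n} => B ji.1 ji.2)
  setT
    (enum {: 'I_p * {ffun 'I_p -> 'I_n}}).
  rewrite (_ : (fun ji => _) = fun ji => all_rv A g G B (inr ji)).
    apply: (mutually_independent_gauss_indep
      (h := fun i => inr i : all_index n p) ind) => [i j []//|[j i]].
    exact: stdB.
  by apply/funext => -[].
have k0 : 0 <= (Num.sqrt (n%:R : R))^-1 by rewrite invr_ge0 sqrtr_ge0.
split; rewrite /xi_l /xi /xi_u !unlock.
  apply: log_moment_le => //.
    by apply: integral_ge0 => w _; rewrite lee_fin expR_ge0.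
  exact: (lower_comparison p0 Ssph Sn0 mA iA (fun j i => (stdB j i).1) podd iB).
have := @upper_comparison _ _ _ P _ _ S p0 Ssph Sn0 A mA iA G c3u
  (fun j i => (stdG j i).1) iG c3u0.
have E0 : (0 <= \int[P]_w (expR (c3u * phi S (fun i => A i w)))%:E)%E.
  by apply: integral_ge0 => w _; rewrite lee_fin expR_ge0.
move=> /(log_moment_shift_le k0 c3u0 E0).
(* The logarithm of the added Gaussian's moment, divided by [c3u], is the correction term of
   [xi_u]. *)
have -> // : - (c3u^-1 * (c3u ^+ 2 * (p%:R - 1) / 2)) = - (c3u / 2) * (p%:R -
  1).
by field; rewrite gt_eqF.
Qed.
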